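(* Let $k$ be an algebraically closed field of arbitrary characteristic and let $n\ge 2$ be an integer. Then a general Fano hypersurface $X$ of degree $n$ in $\mathbb{P}^n_k$ contains a minimal very free rational curve of degree $n$: there is a morphism $f:\mathbb{P}^1_k\to X$ with $\deg f^*\mathcal{O}_{\mathbb{P}^n}(1)=n$ and $$f^*TX\cong \mathcal{O}_{\mathbb{P}^1}(2)\oplus\mathcal{O}_{\mathbb{P}^1}(1)^{\oplus(n-2)}.$$
   Context: A Fano variety is a smooth projective variety with ample anticanonical bundle; a smooth hypersurface of degree $d$ in $\mathbb{P}^n$ is Fano iff $d\le n$. ''General'' means: for all hypersurfaces in a nonempty (hence dense) Zariski open subset of the projective space $\mathbb{P}(H^0(\mathbb{P}^n_k,\mathcal{O}(n)))$ parametrizing hypersurfaces of degree $n$ (smooth ones forming an open dense subset). $TX$ denotes the tangent bundle of $X$. A very free curve in $X$ is a morphism $f:\mathbb{P}^1\to X$ with image in the smooth locus of $X$ and $f^*TX$ ample. *)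

(* Defs.v *)
From mathcomp Require Export all_boot all_order all_algebra.
From mathcomp.multinomials Require Export freeg mpoly.

Set Implicit Arguments.
Unset Strict Implicit.
Unset Printing Implicit Defensive.

Import GRing.Theory.
Local Open Scope ring_scope.

(* A point of the projective space P^(N-1)(k) is given by a nonzero vector of
   homogeneous coordinates, and a subset of it by the cone of all the vectors
   of coordinates of its points (0 excluded). *)
Definition proj_point (k : fieldType) (N : nat) (c : 'I_N -> k) : Prop :=
  exists i, c i != 0.

Definition proj_open (k : fieldType) (N : nat) (U : ('I_N -> k) -> Prop) : Prop :=
  exists S : {mpoly k[N]} -> Prop,
    (forall G, S G -> exists d, G \is d.-homog) /\
    (forall c, U c <-> proj_point c /\ (exists2 G, S G & G.@[c] != 0)).

Definition nonempty_open (k : fieldType) (N : nat) (U : ('I_N -> k) -> Prop) :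
    Prop :=
  proj_open U /\ exists c, U c.

(* Homogeneous coordinates on P(H^0(P^n, O(d))): the coefficients of a form of
   degree d in n.+1 variables, indexed by the monomials of degree d. *)
Definition monoms (n d : nat) : {set 'X_{1..n.+1 < d.+1}} :=
  [set m : 'X_{1..n.+1 < d.+1} | mdeg m == d].

Definition coefs (k : fieldType) (n d : nat) (F : {mpoly k[n.+1]}) :
    'I_#|monoms n d| -> k :=
  fun i => F@_(enum_val i).
Arguments coefs {k} n d F.

(* F is tested together with its partial derivatives: Euler's relation does not
   give F from them when the characteristic divides the degree. *)
Definition smooth_hypersurface (k : fieldType) (n : nat) (F : {mpoly k[n.+1]}) :
    Prop :=
  forall p : 'I_n.+1 -> k, proj_point p -> F.@[p] = 0 ->
    exists j, (F^`M(j)).@[p] != 0.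

Definition fano_hypersurface (k : fieldType) (n d : nat)
    (F : {mpoly k[n.+1]}) : Prop :=
  [/\ F \is d.-homog, (0 < d)%N, F != 0, smooth_hypersurface F & (d <= n)%N].

(* A morphism f : P^1 -> P^n with f^*O(1) of degree e is given by n.+1 binary
   forms of degree e without common zero on P^1. *)
Definition P1_morphism (k : fieldType) (n e : nat)
    (f : n.+1.-tuple {mpoly k[2]}) : Prop :=
  (forall i, tnth f i \is e.-homog) /\
  (forall p : 'I_2 -> k, proj_point p -> exists i, (tnth f i).@[p] != 0).

Definition lies_on (k : fieldType) (n : nat) (f : n.+1.-tuple {mpoly k[2]})
    (F : {mpoly k[n.+1]}) : Prop :=
  F \mPo f = 0.

Notation ratfun k := {fraction {mpoly k[2]}}.
Notation toratfun := (@FracField.tofrac _).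

(* x lies in the stalk at p of O_{P^1}(d), viewed inside k(s, t). *)
Definition regular_at (k : fieldType) (d : nat) (p : 'I_2 -> k)
    (x : ratfun k) : Prop :=
  exists (e : nat) (a b : {mpoly k[2]}),
    [/\ a \is (d + e).-homog, b \is e.-homog, b.@[p] != 0
      & x = toratfun a / toratfun b].

Definition twist (k : fieldType) (d : nat) (U : ('I_2 -> k) -> Prop)
    (x : ratfun k) : Prop :=
  forall p, U p -> regular_at d p x.

(* All the sheaves on P^1 considered here are torsion-free, hence subsheaves of
   a constant sheaf W, with W a k(s, t)-vector space: E U x means that x is a
   section of E over U, and the restriction maps are inclusions.  This only
   makes sense over nonempty U; the sections over the empty set carry no
   information. *)
Definition P1_sheaf (k : fieldType) (W : lmodType (ratfun k)) :=
  (('I_2 -> k) -> Prop) -> W -> Prop.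

Definition sheaf_iso (k : fieldType) (V W : lmodType (ratfun k))
    (E : P1_sheaf V) (E' : P1_sheaf W) : Prop :=
  exists phi : (('I_2 -> k) -> Prop) -> V -> W,
    (forall U, nonempty_open U ->
      [/\ forall x, E U x -> E' U (phi U x),
          forall y, E' U y -> exists2 x, E U x & phi U x = y,
          forall x x', E U x -> E U x' -> phi U x = phi U x' -> x = x'
        & forall c x x', twist 0 U c -> E U x -> E U x' ->
            phi U (c *: x + x') = c *: phi U x + phi U x']) /\
    (forall U U', nonempty_open U -> nonempty_open U' ->
      (forall p, U' p -> U p) -> forall x, E U x -> phi U' x = phi U x).

Definition split_bundle (k : fieldType) (a : seq nat) :
    P1_sheaf 'rV[ratfun k]_(size a) :=
  fun U v => forall j : 'I_(size a), twist (nth 0%N a j) U (v 0 j).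
Arguments split_bundle : clear implicits.

(* The map f in the affine chart x_i != 0 of P^n, with the coordinates
   y_j = x_j / x_i (so that y_i = 1). *)
Definition chart (k : fieldType) (n : nat) (f : n.+1.-tuple {mpoly k[2]})
    (i j : 'I_n.+1) : ratfun k :=
  toratfun (tnth f j) / toratfun (tnth f i).

Definition dF_chart (k : fieldType) (n : nat) (F : {mpoly k[n.+1]})
    (f : n.+1.-tuple {mpoly k[2]}) (i j : 'I_n.+1) : ratfun k :=
  mmap (fun c : k => toratfun c%:MP) (chart f i) (F^`M(j)).

(* f^*TX for the hypersurface X = {F = 0}.  Row i of v is a section of the
   pullback of the tangent bundle of the affine hypersurface X /\ {x_i != 0},
   which is the kernel of the Jacobian of the dehomogenized equation, written in
   the coordinates dy_j (the i-th one being zero).  The rows are glued by the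
   differential of the change of charts y_j |-> y_j / y_l.  A chart that does
   not meet the image of f (f_i = 0) contributes nothing. *)
Definition pullback_tangent (k : fieldType) (n : nat) (F : {mpoly k[n.+1]})
    (f : n.+1.-tuple {mpoly k[2]}) : P1_sheaf 'M[ratfun k]_n.+1 :=
  fun U v =>
    [/\ forall i j p, U p -> (tnth f i).@[p] != 0 -> regular_at 0 p (v i j),
        forall i, v i i = 0,
        forall i, tnth f i != 0 -> \sum_j dF_chart F f i j * v i j = 0,
        forall i l j, tnth f i != 0 -> tnth f l != 0 ->
          v l j = (chart f i l * v i j - chart f i j * v i l)
                    / chart f i l ^+ 2
      & forall i j, tnth f i = 0 -> v i j = 0].

(* Main.v *)
(* A form vanishing on the rational normal curve C = (s^n : s^(n-1) t : ... : t^n)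
   has on C a gradient of the form t^2 r_j - 2 s t r_{j-1} + s^2 r_{j-2}, with
   binary forms r_0, ..., r_{n-2} of degree (n + 1)(n - 2), and the normal bundle of
   C in the hypersurface consists of the syzygies of r in O(n + 2)^(n-1).  If r has
   no nonzero syzygy of degree n, then its n - 2 independent syzygies of degree
   n + 1 form a basis at every point of P^1, the normal bundle is O(1)^(n-2), and
   the extension of it by O(2) = TP^1 splits.

   Up to a linear change of coordinates A, the form is determined by A and a form G
   vanishing on C.  At A = 1 and G = sum_l x_0^(n-2-l) x_n^l (x_l x_{l+2} - x_{l+1}^2),
   where r_l = s^((n+1)(n-2-l)) t^((n+1) l), the map (A, G) |-> G o A is submersive,
   hence dominant, and r has no syzygy of degree n.  By elimination of quantifiers the
   image of a dominant polynomial map contains a nonempty open set, so a general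
   form is obtained in this way with r still satisfying the condition above. *)

From HB Require Import structures.
Require Import Defs.
From mathcomp Require Import all_boot all_order all_algebra.
From mathcomp.multinomials Require Import freeg mpoly.
From mathcomp Require Import perm closed_field ring zify.

Set Implicit Arguments.
Unset Strict Implicit.
Unset Printing Implicit Defensive.

Import GRing.Theory.
Local Open Scope ring_scope.

(** The argument has to hold in every characteristic, where differentiating the curve or using
    Euler's relation may lose information. The r_l are therefore given by a formula: a form
    vanishing on C is a combination of differences of monomials of equal weight, and the gradient of
    such a binomial is summed twice by an identity between natural numbers. The degrees fit exactly.
    A syzygy of degree n has (n - 1)(n + 1) coefficients and must kill a form of degree n^2 - 2,
    which has as many, so the absence of such syzygies is the nonvanishing of a determinant. In
    degree n + 1 there are (n - 1)(n + 2) unknowns for n^2 equations, which leaves n - 2 solutions.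
    The splitting is made explicit: the syzygies lift to vectors of forms of degree n because
    H^1(P^1, O(1)) = 0, and these lifts, together with the tangent direction of C, are the
    generators of the bundle. Smoothness does not follow from the construction along C. It is a
    second open condition, met by an explicit form that depends on whether the characteristic
    divides n, and the two nonempty open sets meet. *)

Section MpolyBasics.
Variable R : comNzRingType.

Lemma mpoly_ring_ind n (P : {mpoly R[n]} -> Prop) :
  (forall c, P c%:MP) -> (forall i, P 'X_i) ->
  (forall p q, P p -> P q -> P (p + q)) -> (forall p q, P p -> P q -> P (p * q)) ->
  forall p, P p.
Proof.
move=> PC PX PD PM; apply: mpolyind => [|c m q _ _ Pq]; first exact: (PC 0).
apply: PD => //; rewrite -mul_mpolyC; apply: (PM) => //; rewrite mpolyXE_id.
apply: (big_ind P); [exact: (PC 1)|exact: PM|].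
by move=> i _; elim: (m i) => [|e IHe]; [apply: (PC 1)|rewrite exprS; apply: PM].
Qed.

Lemma mderivXU n (i j : 'I_n) : ('X_i : {mpoly R[n]})^`M(j) = (i == j)%:R.
Proof.
rewrite mderivX mnm1E; case: eqP => [->|_]; last by rewrite scale0r.
rewrite scale1r (_ : (U_(j) - U_(j))%MM = 0%MM) ?mpolyX0 //.
by apply/mnmP => l; rewrite !mnmE subnn.
Qed.

Lemma dhomogC n (c : R) : c%:MP \is [in R[n], 0.-homog].
Proof. by rewrite -[c]mulr1 mpolyCM mul_mpolyC; apply/dhomogZ/dhomog1. Qed.

End MpolyBasics.

(** * Dominant polynomial maps over an algebraically closed field *)

Section KroneckerSubstitution.

Lemma digits_inj (B n : nat) (f g : 'I_n -> nat) :
  (forall i, f i < B)%N -> (forall i, g i < B)%N ->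
  (\sum_(i < n) f i * B ^ i = \sum_(i < n) g i * B ^ i)%N -> f =1 g.
Proof.
elim: n f g => [|n IH] f g fB gB; first by move=> _ [].
rewrite !big_ord_recl !expn0 !muln1.
have shift (h : 'I_n.+1 -> nat) :
  (\sum_(i < n) h (fintype.lift ord0 i) * B ^ fintype.lift ord0 i =
    (\sum_(i < n) h (fintype.lift ord0 i) * B ^ i) * B)%N.
  by rewrite big_distrl; apply: eq_bigr => i _; rewrite /= /bump add1n expnSr mulnA.
rewrite !shift => eqfg.
have B0 : (0 < B)%N by apply: leq_ltn_trans (fB ord0).
have /(congr1 (modn^~ B)) := eqfg.
rewrite !(addnC (_ ord0)) !modnMDl !modn_small // => eq0.
move: eqfg; rewrite eq0 => /addnI/eqP; rewrite eqn_pmul2r // => /eqP.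
move/(IH _ _ (fun i => fB _) (fun i => gB _)) => eqS i.
by case: (unliftP ord0 i) => [j ->|->]; [apply: eqS|].
Qed.

(** Since [B] exceeds every exponent in [p], substituting u^(B^i) for the i-th variable sends
    distinct monomials to distinct powers of u. The resulting univariate polynomial is nonzero and
    has a non-root. *)
Lemma mpoly_nonzero_eval (k : closedFieldType) n (p : {mpoly k[n]}) :
  p != 0 -> exists c : 'I_n -> k, p.@[c] != 0.
Proof.
move=> p0; pose B := msize p.
pose q := mmap polyC (fun i : 'I_n => 'X^(B ^ i)) p.
have mmap1E m : mmap1 (fun i : 'I_n => 'X^(B ^ i)) m =
    'X^(\sum_(i < n) m i * B ^ i) :> {poly k}.
  by rewrite -prodrXr; apply: eq_bigr => i _; rewrite -exprM mulnC.
have q0 : q != 0.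
  have/mlead_supp := p0; set m0 := mlead p => m0p.
  suff: q`_(\sum_(i < n) m0 i * B ^ i) != 0.
    by apply: contraNneq => ->; rewrite coef0.
  rewrite /q /mmap coef_sum (bigD1_seq m0) ?msupp_uniq //= [X in _ + X]big1_seq ?addr0.
    by rewrite coefCM mmap1E coefXn eqxx mulr1 -mcoeff_msupp.
  move=> m /andP[neq mp]; rewrite coefCM mmap1E coefXn.
  case: eqP => [/digits_inj H|]; last by rewrite mulr0.
  suff ltB m' i : m' \in msupp p -> (m' i < B)%N.
    by case/eqP: neq; apply/mnmP => i; rewrite -H // => j; apply: ltB.
  move/msize_mdeg_lt; apply: leq_ltn_trans.
  by rewrite mdegE (bigD1 i) //= leq_addr.
have /closed_nonrootP[u] := q0; rewrite /root => qu.
exists (fun i => u ^+ (B ^ i)); apply: contraNneq qu => pu.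
suff -> : q.[u] = p.@[fun i => u ^+ (B ^ i)] by rewrite pu.
rewrite /q /mmap horner_sum mevalE; apply: eq_bigr => m _.
rewrite hornerM hornerC; congr (_ * _); rewrite /mmap1 horner_prod.
by apply: eq_bigr => i _; rewrite !hornerE.
Qed.

End KroneckerSubstitution.

Section Constructible.
Variable k : closedFieldType.
Local Notation term := (GRing.term k).
Local Notation formula := (GRing.formula k).
Local Notation qelim := (GRing.quantifier_elim (@ClosedFieldQE.ex_elim k)).

Definition env n (c : 'I_n -> k) : seq k := [seq c i | i <- enum 'I_n].

Lemma nth_env n (c : 'I_n -> k) (i : 'I_n) : (env c)`_i = c i.
Proof. by rewrite (nth_map i) ?size_enum_ord // nth_ord_enum. Qed.

Lemma size_env n (c : 'I_n -> k) : size (env c) = n.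
Proof. by rewrite size_map size_enum_ord. Qed.

(** Only terms without inverse are meant ([GRing.rterm]), so the value at [GRing.Inv] is a dummy. A
    variable beyond the environment is 0, in agreement with the default of [nth]. *)
Fixpoint mpoly_of_term n (t : term) : {mpoly k[n]} :=
  match t with
  | GRing.Var i => if insub i is Some j then 'X_j else 0
  | GRing.Const c => c%:MP
  | GRing.NatConst m => m%:R
  | GRing.Add t1 t2 => mpoly_of_term n t1 + mpoly_of_term n t2
  | GRing.Opp t1 => - mpoly_of_term n t1
  | GRing.NatMul t1 m => mpoly_of_term n t1 *+ m
  | GRing.Mul t1 t2 => mpoly_of_term n t1 * mpoly_of_term n t2
  | GRing.Inv t1 => 0
  | GRing.Exp t1 m => mpoly_of_term n t1 ^+ m
  end.

Lemma eval_mpoly_of_term n (c : 'I_n -> k) t : GRing.rterm t ->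
  (mpoly_of_term n t).@[c] = GRing.eval (env c) t.
Proof.
elim: t => //=.
- move=> i _; case: insubP => [j lt_in def_j|].
    by rewrite mevalXU -def_j nth_env.
  by rewrite -leqNgt => le_ni; rewrite meval0 nth_default ?size_env.
- by move=> x _; rewrite mevalC.
- by move=> m _; rewrite rmorph_nat.
- by move=> t1 IH1 t2 IH2 /andP[r1 r2]; rewrite mevalD IH1 ?IH2.
- by move=> t1 IH1 r1; rewrite mevalN IH1.
- by move=> t1 IH1 m r1; rewrite mevalMn IH1.
- by move=> t1 IH1 t2 IH2 /andP[r1 r2]; rewrite mevalM IH1 ?IH2.
- by move=> t1 IH1 m r1; rewrite rmorphXn /= IH1.
Qed.

(** An equation is either an identity or false wherever the difference of its sides is nonzero; a
    connective is handled on the intersection of two such open sets, which the product of their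
    equations defines. *)
Lemma qf_eval_generic n (f : formula) : GRing.qf_form f && GRing.rformula f ->
  exists2 P : {mpoly k[n]}, P != 0 & exists b, forall c : 'I_n -> k,
    P.@[c] != 0 -> GRing.qf_eval (env c) f = b.
Proof.
have bin (g : bool -> bool -> bool) (u v : ('I_n -> k) -> bool) :
    (exists2 P : {mpoly k[n]}, P != 0 & exists b, forall c, P.@[c] != 0 -> u c = b) ->
    (exists2 P : {mpoly k[n]}, P != 0 & exists b, forall c, P.@[c] != 0 -> v c = b) ->
    exists2 P : {mpoly k[n]}, P != 0 &
      exists b, forall c, P.@[c] != 0 -> g (u c) (v c) = b.
  move=> [P P0 [a Pa]] [Q Q0 [b Qb]]; exists (P * Q); first by rewrite mulf_neq0.
  exists (g a b) => c; rewrite mevalM mulf_eq0 => /norP[Pc Qc].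
  by rewrite Pa ?Qb.
elim: f => //=.
- by move=> b _; exists 1; rewrite ?oner_neq0 //; exists b.
- move=> t1 t2 /andP[r1 r2].
  have [eq12|neq12] := eqVneq (mpoly_of_term n t1) (mpoly_of_term n t2).
    exists 1; rewrite ?oner_neq0 //; exists true => c _.
    by rewrite -!eval_mpoly_of_term // eq12 eqxx.
  exists (mpoly_of_term n t1 - mpoly_of_term n t2); rewrite ?subr_eq0 //.
  exists false => c; rewrite mevalB subr_eq0 !eval_mpoly_of_term //.
  exact: negbTE.
- move=> f1 IH1 f2 IH2 /andP[/andP[q1 q2] /andP[r1 r2]].
  by apply: bin; [apply: IH1; rewrite q1|apply: IH2; rewrite q2].
- move=> f1 IH1 f2 IH2 /andP[/andP[q1 q2] /andP[r1 r2]].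
  by apply: bin; [apply: IH1; rewrite q1|apply: IH2; rewrite q2].
- move=> f1 IH1 f2 IH2 /andP[/andP[q1 q2] /andP[r1 r2]].
  by apply: (bin implb); [apply: IH1; rewrite q1|apply: IH2; rewrite q2].
- move=> f1 IH1 q1; have [P P0 [b Pb]] := IH1 q1.
  by exists P => //; exists (~~ b) => c /Pb->.
Qed.

Definition term_of_mpoly n (o : nat) (p : {mpoly k[n]}) : term :=
  \big[GRing.Add/GRing.NatConst k 0]_(m <- msupp p)
    GRing.Mul (GRing.Const p@_m)
      (\big[GRing.Mul/GRing.NatConst k 1]_(i < n)
         GRing.Exp (GRing.Var k (o + i)) (m i)).

Lemma rterm_of_mpoly n o (p : {mpoly k[n]}) : GRing.rterm (term_of_mpoly o p).
Proof.
rewrite /term_of_mpoly; elim/big_rec: _ => //= m t _ ->; rewrite andbT.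
by elim/big_rec: _.
Qed.

Lemma eval_term_of_mpoly n o (p : {mpoly k[n]}) e :
  GRing.eval e (term_of_mpoly o p) = p.@[fun i => e`_(o + i)].
Proof.
rewrite mevalE /term_of_mpoly.
rewrite (big_morph (GRing.eval e) (id1 := 0) (op1 := +%R)) //.
apply: eq_bigr => m _ /=; congr (_ * _).
by rewrite (big_morph (GRing.eval e) (id1 := 1) (op1 := *%R)).
Qed.

(** A weak form of Chevalley's theorem: elimination of quantifiers turns membership in the image of
    {D != 0} into a quantifier-free condition, which is generically constant. *)
Lemma image_generic M N (Phi : 'I_N -> {mpoly k[M]}) (D : {mpoly k[M]}) :
  let S c := exists2 x : 'I_M -> k, forall i, (Phi i).@[x] = c i & D.@[x] != 0 in
  exists2 P : {mpoly k[N]}, P != 0 &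
    (forall c, P.@[c] != 0 -> S c) \/ (forall c, P.@[c] != 0 -> ~ S c).
Proof.
(* The variables 0, ..., N - 1 stand for the coordinates of c, and N, ..., N + M - 1 for those of x,
   which are then quantified. *)
move=> S; pose body : formula := GRing.And
  (\big[GRing.And/GRing.Bool true]_(i < N)
      GRing.Equal (GRing.Var k i) (term_of_mpoly N (Phi i)))
  (GRing.Not (GRing.Equal (term_of_mpoly N D) (GRing.NatConst k 0))).
pose f := foldr (@GRing.Exists k) body (iota N M).
have rf : GRing.rformula f.
  suff rb : GRing.rformula body by rewrite /f; elim: (iota N M).
  rewrite /= rterm_of_mpoly !andbT; elim/big_rec: _ => //= i g _ ->.
  by rewrite rterm_of_mpoly.
have fP c : GRing.holds (env c) f <-> S c.
  have holdsE e : GRing.holds e body <->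
      (forall i : 'I_N, (Phi i).@[fun j => e`_(N + j)] = e`_i) /\
      D.@[fun j => e`_(N + j)] != 0.
    rewrite /= eval_term_of_mpoly.
    have andE (F : 'I_N -> formula) :
        GRing.holds e (\big[GRing.And/GRing.Bool true]_(i < N) F i) <->
        forall i, GRing.holds e (F i).
      elim: N F {D Phi S c body f rf} => [|N' IH] F.
        by rewrite big_ord0; split=> [_ []|].
      rewrite big_ord_recl /=; split=> [[F0 /IH FS] i|FP].
        by case: (unliftP ord0 i) => [j ->|->].
      by split=> //; apply/IH => i.
    split=> [[/andE eqs /eqP D0]|[eqs /eqP D0]]; split=> //.
      by move=> i; rewrite -eval_term_of_mpoly -eqs.
    by apply/andE => i /=; rewrite eval_term_of_mpoly eqs.
  split=> [/GRing.foldExistsP[e eqe /holdsE[eqs D0]]|[x eqs D0]].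
    exists (fun j => e`_(N + j)) => // i; rewrite eqs -eqe ?nth_env //.
    by rewrite !inE mem_iota leqNgt ltn_ord.
  apply/GRing.foldExistsP; pose e := env c ++ env x.
  have eN (j : 'I_M) : e`_(N + j) = x j.
    by rewrite nth_cat size_env ltnNge leq_addr /= addKn nth_env.
  exists e.
    move=> i; rewrite !inE mem_iota negb_and -ltnNge -leqNgt /e nth_cat size_env.
    case: ltnP => // le_Ni /= le_i; rewrite !nth_default ?size_env //.
    by rewrite leq_subRL.
  apply/holdsE; split; first move=> i.
    by rewrite (meval_eq _ eN) eqs /e nth_cat size_env ltn_ord nth_env.
  by rewrite (meval_eq _ eN).
have wf := ClosedFieldQE.wf_ex_elim (F := k).
have ok := ClosedFieldQE.holds_ex_elim (@GRing.solve_monicpoly k).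
have [P P0 [b Pb]] := @qf_eval_generic N _ (GRing.quantifier_elim_wf wf rf).
exists P => //; case: b Pb => Pb; [left|right] => c /Pb qc.
  by apply/fP/(GRing.quantifier_elim_rformP wf ok _ rf).
by move/fP/(GRing.quantifier_elim_rformP wf ok _ rf); rewrite qc.
Qed.

End Constructible.

Section Taylor.
Variables (R S : comNzRingType) (phi : {rmorphism R -> S}).

Lemma mmap_taylor n (p : {mpoly R[n]}) (x y : 'I_n -> S) (h : S) :
  exists rho, mmap phi (fun i => x i + h * y i) p =
    mmap phi x p + h * \sum_j y j * mmap phi x p^`M(j) + h ^+ 2 * rho.
Proof.
pose d p := \sum_j y j * mmap phi x p^`M(j); rewrite -/(d p).
elim/mpoly_ring_ind: p => [c|i|p q [r1 E1] [r2 E2]|p q [r1 E1] [r2 E2]].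
- exists 0; rewrite !mmapC /d big1 ?mulr0 ?addr0 // => j _.
  by rewrite mderivC mmap0 mulr0.
- exists 0; rewrite !mmapX !mmap1U mulr0 addr0 /d (bigD1 i) //= big1 => [|j neq].
    by rewrite mderivXU eqxx rmorph1 mulr1 addr0.
  by rewrite mderivXU eq_sym (negbTE neq) mmap0 mulr0.
- exists (r1 + r2); rewrite !mmapD E1 E2.
  have -> : d (p + q) = d p + d q.
    by rewrite -big_split; apply: eq_bigr => j _; rewrite /= mderivD mmapD mulrDr.
  ring.
have dM : d (p * q) = d p * mmap phi x q + mmap phi x p * d q.
  rewrite /d mulr_suml mulr_sumr -big_split; apply: eq_bigr => j _ /=.
  rewrite mderivM mmapD !rmorphM /=; ring.
exists (r1 * mmap phi x q + mmap phi x p * r2 + d p * d q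
  + h * (r1 * d q + d p * r2) + h ^+ 2 * r1 * r2).
rewrite dM !rmorphM /= E1 E2; ring.
Qed.

End Taylor.

Section EvaluationAlongCurve.
Variable k : fieldType.

Lemma horner_mmap_polyC n (g : 'I_n -> {poly k}) p u :
  (mmap polyC g p).[u] = p.@[fun i => (g i).[u]].
Proof.
rewrite /mmap horner_sum mevalE; apply: eq_bigr => m _.
rewrite hornerM hornerC horner_prod; congr (_ * _).
by apply: eq_bigr => i _; rewrite horner_exp.
Qed.

Lemma mmap_polyC_const n (x : 'I_n -> k) p :
  mmap polyC (fun i => (x i)%:P) p = (p.@[x])%:P.
Proof.
rewrite mevalE /mmap rmorph_sum; apply: eq_bigr => m _.
rewrite rmorphM rmorph_prod; congr (_ * _).
by apply: eq_bigr => i _; rewrite rmorphXn.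
Qed.

End EvaluationAlongCurve.

Section Hensel.
Variable k : closedFieldType.
Variables (M N : nat) (Phi : 'I_N -> {mpoly k[M]}) (x0 : 'I_M -> k).
Hypothesis jacobian_surj : forall w : 'I_N -> k, exists y : 'I_M -> k,
  forall i, \sum_j y j * ((Phi i)^`M(j)).@[x0] = w i.

(** Newton's iteration: adding X^(m+1) y to x changes Phi by X^(m+1) times the differential at x0
    applied to y, modulo X^(m+2), and y is chosen to cancel the constant term of the error. The
    quadratic term X^(2m+2) is absorbed. *)
Lemma hensel_lift (w : 'I_N -> k) m : exists x : 'I_M -> {poly k},
  (forall j, (x j).[0] = x0 j) /\
  forall i, exists rho, mmap polyC x (Phi i) =
    ((Phi i).@[x0])%:P + 'X * (w i)%:P + 'X^(m.+1) * rho.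
Proof.
elim: m => [|m [x [x_0 xP]]].
  exists (fun j => (x0 j)%:P); split=> [j|i]; first by rewrite hornerC.
  by exists (- (w i)%:P); rewrite expr1 mulrN addrK mmap_polyC_const.
have [rho rhoP] := fin_all_exists xP.
have [y yP] := jacobian_surj (fun i => - (rho i).[0]).
exists (fun j => x j + 'X^(m.+1) * (y j)%:P); split=> [j|i].
  by rewrite !hornerE expr0n mul0r addr0.
have [r ->] := mmap_taylor polyC (Phi i) x (fun j => (y j)%:P) 'X^(m.+1).
set d := \sum_j _.
have /factor_theorem[q] : root (rho i + d) 0.
  rewrite /root hornerD horner_sum.
  under eq_bigr do rewrite hornerM hornerC horner_mmap_polyC (meval_eq _ x_0).
  by rewrite yP subrr.
rewrite subr0 => dE; exists (q + 'X^m * r).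
have -> : d = q * 'X - rho i by rewrite -dE addrC addKr.
rewrite rhoP !exprS; ring.
Qed.

(* The arcs given by [hensel_lift] show that P restricted to any line through
   Phi(x0) vanishes to arbitrary order; unlike an argument with the gradient of
   P, this works in every characteristic. *)
Lemma submersion_dominant (P : {mpoly k[N]}) :
  (forall x, P.@[fun i => (Phi i).@[x]] = 0) -> P = 0.
Proof.
move=> PPhi; apply/eqP; apply: contraT => /mpoly_nonzero_eval[c].
set w : 'I_N -> k := fun i => c i - (Phi i).@[x0].
pose line := mmap polyC (fun i => ((Phi i).@[x0])%:P + 'X * (w i)%:P) P.
have -> : P.@[c] = line.[1].
  rewrite horner_mmap_polyC; apply: meval_eq => i.
  by rewrite hornerD hornerM hornerX !hornerC mul1r /w addrC subrK.
suff -> : line = 0 by rewrite horner0 eqxx.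
have [x [_ xP]] := hensel_lift w (size line).
have [rho rhoP] := fin_all_exists xP.
have [r] := mmap_taylor polyC P
  (fun i => ((Phi i).@[x0])%:P + 'X * (w i)%:P) rho 'X^((size line).+1).
have -> : mmap polyC (fun i => ((Phi i).@[x0])%:P + 'X * (w i)%:P +
    'X^((size line).+1) * rho i) P = 0.
  apply/eqP; apply: contraT => /closed_nonrootP[u]; rewrite /root horner_mmap_polyC.
  rewrite (@meval_eq _ _ _ (fun i => (Phi i).@[fun j => (x j).[u]])) ?PPhi ?eqxx //.
  by move=> i; rewrite -rhoP horner_mmap_polyC.
rewrite -/line => /esym/eqP; rewrite -addrA addr_eq0 => /eqP lineE.
apply/eqP; apply: contraT => line0.
have : 'X^((size line).+1) %| line.
  by rewrite [X in _ %| X]lineE -dvdpNr opprK expr2 -mulrA -mulrDr dvdp_mulIl.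
by move/dvdp_leq => /(_ line0); rewrite size_polyXn ltnNge leqnSn.
Qed.

(** If the generic point avoided the image, P o Phi would vanish wherever D does not, hence
    everywhere, against dominance. *)
Theorem submersion_image (D : {mpoly k[M]}) : D != 0 ->
  exists2 P : {mpoly k[N]}, P != 0 &
    forall c, P.@[c] != 0 ->
      exists2 x : 'I_M -> k, forall i, (Phi i).@[x] = c i & D.@[x] != 0.
Proof.
move=> D0; have [P P0 [|PS]] := image_generic Phi D; first by exists P.
have PPhi0 : (P \mPo [tuple Phi i | i < N]) * D = 0.
  apply/eqP; apply: contraT => /mpoly_nonzero_eval[x].
  rewrite mevalM mulf_eq0 comp_mpoly_meval => /norP[Px Dx].
  by case: (PS _ Px); exists x => // i; rewrite tnth_mktuple.
case/eqP: P0; apply: submersion_dominant => x.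
move/eqP: PPhi0; rewrite mulf_eq0 (negbTE D0) orbF => /eqP/(congr1 (meval x)).
rewrite comp_mpoly_meval meval0 => <-.
by apply: meval_eq => i; rewrite tnth_mktuple.
Qed.

End Hensel.

(** * Binary forms *)

Section BinaryForms.
Variable k : fieldType.
Implicit Types (p : 'I_2 -> k) (P Q : {poly k}).

Definition hs : {mpoly k[2]} := 'X_ord0.
Definition ht : {mpoly k[2]} := 'X_ord_max.

(* A binary form of degree d is encoded by its dehomogenization at s = 1, a
   univariate polynomial of size at most d + 1 (higher coefficients are lost). *)
Definition bform (d : nat) P : {mpoly k[2]} :=
  \sum_(i < d.+1) P`_i *: (hs ^+ (d - i) * ht ^+ i).

Definition dehom : {mpoly k[2]} -> {poly k} :=
  mmap polyC (fun i : 'I_2 => 'X ^+ i).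

HB.instance Definition _ := GRing.RMorphism.on dehom.

Lemma dhomog_hs e : hs ^+ e \is e.-homog.
Proof. by have := @dhomogMn _ _ _ 1 hs e; rewrite mul1n; apply; rewrite dhomogX /= mdeg1. Qed.

Lemma dhomog_ht e : ht ^+ e \is e.-homog.
Proof. by have := @dhomogMn _ _ _ 1 ht e; rewrite mul1n; apply; rewrite dhomogX /= mdeg1. Qed.

Lemma dhomog_bform d P : bform d P \is d.-homog.
Proof.
apply: rpred_sum => i _; apply: rpredZ.
by have := dhomogM (dhomog_hs (d - i)) (dhomog_ht i); rewrite subnK // -ltnS.
Qed.

Lemma bform_is_linear d : linear (bform d).
Proof.
move=> c P Q; rewrite /bform scaler_sumr -big_split; apply: eq_bigr => i _ /=.
by rewrite coefD coefZ scalerDl scalerA.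
Qed.
HB.instance Definition _ d := GRing.isLinear.Build k {poly k} {mpoly k[2]} _ (bform d)
  (bform_is_linear d).

Lemma bformXn d i : (i <= d)%N -> bform d 'X^i = hs ^+ (d - i) * ht ^+ i.
Proof.
move=> le_id; rewrite /bform (bigD1 (Ordinal (le_id : (i < d.+1)%N))) //= coefXn eqxx scale1r.
rewrite big1 ?addr0 // => j neq; rewrite coefXn.
by case: eqP => [eqji|]; rewrite ?scale0r //; case/eqP: neq; apply: val_inj.
Qed.

Lemma dehom_hs : dehom hs = 1.
Proof. by rewrite /dehom /hs mmapX mmap1U. Qed.

Lemma dehom_ht : dehom ht = 'X.
Proof. by rewrite /dehom /ht mmapX mmap1U. Qed.

Lemma dehomZ c q : dehom (c *: q) = c *: dehom q.
Proof. by rewrite /dehom mmapZ mul_polyC. Qed.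

Lemma dehomE q : dehom q = \sum_(m <- msupp q) q@_m *: 'X^(m ord_max).
Proof.
rewrite /dehom /mmap; apply: eq_bigr => m _.
rewrite mul_polyC /mmap1 big_ord_recl big_ord1 expr0 expr1n mul1r.
by rewrite (_ : fintype.lift ord0 ord0 = ord_max) //; apply: val_inj.
Qed.

Lemma bformK d P : (size P <= d.+1)%N -> dehom (bform d P) = P.
Proof.
move=> sP; rewrite /bform raddf_sum -[RHS](take_poly_id sP) /take_poly poly_def.
apply: eq_bigr => i _.
by rewrite /= dehomZ rmorphM !rmorphXn /= dehom_hs dehom_ht expr1n mul1r.
Qed.

Lemma dehomK d q : q \is d.-homog -> bform d (dehom q) = q.
Proof.
move=> /dhomogP qd; rewrite dehomE linear_sum [RHS]mpolyE.
apply: eq_big_seq => m /qd /= md; rewrite linearZ /=; congr (_ *: _).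
move: md; rewrite mdegE big_ord_recl big_ord1 => md.
rewrite (mpolyXE_id _ m) big_ord_recl big_ord1.
have eq1 : fintype.lift ord0 ord0 = ord_max :> 'I_2 by apply: val_inj.
by rewrite eq1 in md *; rewrite bformXn -md ?addnK // leq_addl.
Qed.

Lemma bformM d e P Q : (size P <= d.+1)%N -> (size Q <= e.+1)%N ->
  bform d P * bform e Q = bform (d + e) (P * Q).
Proof.
move=> sP sQ; rewrite -(dehomK (dhomogM (dhomog_bform d P) (dhomog_bform e Q))).
by rewrite rmorphM /= !bformK.
Qed.

Lemma bform_eq0 d P : (size P <= d.+1)%N -> bform d P = 0 -> P = 0.
Proof. by move=> sP /(congr1 dehom); rewrite bformK // rmorph0. Qed.

Lemma size_dehom d q : q \is d.-homog -> (size (dehom q) <= d.+1)%N.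
Proof.
move=> /dhomogP qd; rewrite dehomE.
apply: (leq_trans (size_sum _ _ _)); apply/bigmax_leqP_seq => m /qd /= md _.
apply: (leq_trans (size_scale_leq _ _)); rewrite size_polyXn ltnS -md mdegE.
by rewrite (bigD1 ord_max) //= leq_addr.
Qed.

Lemma meval_bform d P p :
  (bform d P).@[p] = \sum_(i < d.+1) P`_i * (p ord0 ^+ (d - i) * p ord_max ^+ i).
Proof.
rewrite /bform raddf_sum; apply: eq_bigr => i _.
by rewrite /= mevalZ mevalM !rmorphXn /= !mevalXU.
Qed.

Lemma proj_point2 p : proj_point p -> p ord0 != 0 \/ (p ord0 = 0 /\ p ord_max != 0).
Proof.
case=> i pi; have [p0|] := eqVneq (p ord0) 0; [right|by left]; split=> //.
suff <- : i = ord_max by [].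
apply: val_inj; case: i pi => [[|[|]]] //= lti.
by rewrite (_ : Ordinal lti = ord0) ?p0 ?eqxx //; apply: val_inj.
Qed.

(** [L] is the linear form of p dehomogenized at s = 1. At the point s = 0 this form is s itself, so
    [L] is 1 and the division shows only in the smaller bound on the size. *)
Lemma bform_root_factor p : proj_point p -> exists2 L : {poly k}, L != 0 &
  forall d P, (size P <= d.+2)%N -> (bform d.+1 P).@[p] = 0 ->
    exists2 Q : {poly k}, (size Q <= d.+1)%N & P = Q * L.
Proof.
case/proj_point2 => [p0|[p0 p1]].
  exists ('X - (p ord_max / p ord0)%:P); first by rewrite polyXsubC_eq0.
  move=> d P sP; rewrite meval_bform => root_p.
  have /factor_theorem[Q PE] : root P (p ord_max / p ord0).
    rewrite /root (horner_coef_wide _ sP) -(mulrI_eq0 _ (mulfI (expf_neq0 d.+1 p0))).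
    rewrite mulr_sumr -[X in _ == X]root_p; apply/eqP; apply: eq_bigr => i _.
    rewrite expr_div_n mulrCA; congr (_ * _); rewrite mulrCA mulrC; congr (_ * _).
    by rewrite expfB_cond // (negbTE p0) add0n -ltnS.
  exists Q => //; have [->|Q0] := eqVneq Q 0; first by rewrite size_poly0.
  by rewrite PE size_Mmonic ?monicXsubC // size_XsubC addn2 in sP.
exists 1; rewrite ?oner_neq0 // => d P sP; rewrite meval_bform.
rewrite big_ord_recr /= subnn expr0 mul1r big1 => [|i _]; last first.
  by rewrite p0 expr0n subn_eq0 leqNgt ltn_ord mul0r mulr0.
move/eqP; rewrite add0r mulf_eq0 expf_eq0 (negbTE p1) andbF orbF => /eqP Pd.
exists P; rewrite ?mulr1 //; apply/leq_sizeP => j.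
by rewrite leq_eqVlt => /predU1P[<- //|/(leq_sizeP _ _ sP)].
Qed.

End BinaryForms.

(** * Local regularity of rational functions and linear systems on P^1 *)

Section Regularity.
Variable k : fieldType.
Variable p : 'I_2 -> k.
Local Notation K := (ratfun k).
Implicit Types (x y : K) (a b : {mpoly k[2]}).

Lemma meval_neq0 b : b.@[p] != 0 -> toratfun b != 0 :> K.
Proof. by apply: contraNneq => /eqP; rewrite tofrac_eq0 => /eqP ->; rewrite meval0. Qed.

Lemma regular_form d a : a \is d.-homog -> regular_at d p (toratfun a).
Proof.
move=> ad; exists 0%N, a, 1; rewrite addn0; split=> //; first exact: dhomog1.
  by rewrite meval1 oner_neq0.
by rewrite tofrac1 divr1.
Qed.

Lemma regular0 d : regular_at d p 0.
Proof. by rewrite -tofrac0; apply: regular_form; apply: dhomog0. Qed.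

Lemma regular_const c : regular_at 0 p (toratfun c%:MP).
Proof. exact/regular_form/dhomogC. Qed.

Lemma regularD d x y : regular_at d p x -> regular_at d p y -> regular_at d p (x + y).
Proof.
move=> [e [a [b [ad be b0 ->]]]] [e' [a' [b' [ad' be' b0' ->]]]].
exists (e + e')%N, (a * b' + a' * b), (b * b'); split.
- by apply: rpredD; [rewrite addnA|rewrite (addnC e) addnA]; apply: dhomogM.
- exact: dhomogM.
- by rewrite mevalM mulf_neq0.
by rewrite tofracD !tofracM addf_div ?meval_neq0.
Qed.

Lemma regularM d d' x y :
  regular_at d p x -> regular_at d' p y -> regular_at (d + d') p (x * y).
Proof.
move=> [e [a [b [ad be b0 ->]]]] [e' [a' [b' [ad' be' b0' ->]]]].
exists (e + e')%N, (a * a'), (b * b'); split.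
- by rewrite addnACA; apply: dhomogM.
- exact: dhomogM.
- by rewrite mevalM mulf_neq0.
by rewrite !tofracM mulf_div.
Qed.

Lemma regularN d x : regular_at d p x -> regular_at d p (- x).
Proof.
move=> [e [a [b [ad be b0 ->]]]]; exists e, (- a), b; split=> //.
  by rewrite dhomogN.
by rewrite tofracN mulNr.
Qed.

Lemma regularB d x y : regular_at d p x -> regular_at d p y -> regular_at d p (x - y).
Proof. by move=> rx ry; apply: regularD => //; apply: regularN. Qed.

Lemma regular_sum d (I : Type) (r : seq I) (P : pred I) (F : I -> K) :
  (forall i, P i -> regular_at d p (F i)) -> regular_at d p (\sum_(i <- r | P i) F i).
Proof.
move=> rF; elim/big_ind: _ => //; first exact: regular0.
by move=> x y; apply: regularD.
Qed.

Lemma regular_div d e x b : b \is e.-homog -> b.@[p] != 0 ->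
  regular_at (d + e) p x -> regular_at d p (x / toratfun b).
Proof.
move=> be b0 [e' [a [b' [ad be' b0' ->]]]].
exists (e + e')%N, a, (b * b'); split; rewrite ?addnA //.
- exact: dhomogM.
- by rewrite mevalM mulf_neq0.
by rewrite tofracM invfM mulrA mulrAC.
Qed.

Lemma dhomog_det m e (M : 'M[{mpoly k[2]}]_m) :
  (forall i j, M i j \is e.-homog) -> \det M \is (m * e).-homog.
Proof.
move=> Me; rewrite /determinant; apply: rpred_sum => s _.
rewrite -signr_odd mulr_sign; set P := \prod_i _.
suff Pd : P \is (m * e).-homog by case: (odd _); rewrite ?dhomogN.
have -> : (m * e)%N = (\sum_(i < m) e)%N by rewrite sum_nat_const card_ord.
rewrite /P; elim/big_rec2: _ => [|i y1 y2 _ IH]; first exact: dhomog1.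
exact: dhomogM.
Qed.

(** A constant right inverse of the fibre of Z at p turns Z into a square matrix of forms with
    determinant 1 at p; Cramer's rule then recovers c with a denominator that does not vanish at
    p. *)
Lemma regular_solve m e N d (Z : 'M[{mpoly k[2]}]_(m, N)) (c : 'rV[K]_m) :
  (forall i j, Z i j \is e.-homog) -> row_free (map_mx (meval p) Z) ->
  (forall j, regular_at (d + e) p ((c *m map_mx toratfun Z) 0 j)) ->
  forall i, regular_at d p (c 0 i).
Proof.
move=> Ze /row_freeP[R ZR] rz i.
pose R' := map_mx (@mpolyC 2 k) R; pose M := Z *m R'.
have Me i1 j1 : M i1 j1 \is e.-homog.
  rewrite mxE; apply: rpred_sum => l _; rewrite [R' _ _]mxE mulrC mul_mpolyC.
  exact: dhomogZ.
have detM : (\det M).@[p] = 1.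
  rewrite -det_map_mx map_mxM -map_mx_comp.
  rewrite (_ : map_mx _ R = R); first by rewrite ZR det1.
  by apply/matrixP=> i1 j1; rewrite mxE /= mevalC.
have rzR j : regular_at (d + e) p ((c *m map_mx toratfun M) 0 j).
  rewrite map_mxM mulmxA mxE; apply: regular_sum => l _.
  by rewrite -[(d + e)%N]addn0; apply: regularM => //; rewrite !mxE; apply: regular_const.
have cE : c 0 i = (c *m map_mx toratfun (M *m \adj M)) 0 i / toratfun (\det M).
  rewrite mul_mx_adj map_scalar_mx mul_mx_scalar mxE mulrAC mulfV ?mul1r //.
  by apply: meval_neq0; rewrite detM oner_neq0.
(* The cofactors of a matrix of size [m.+1] have degree [m * e], which needs the size in successor
   form. *)
rewrite cE; case: m c Z Ze R ZR R' rz i M Me detM rzR {cE}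
  => [|m] c Z Ze R ZR R' rz i M Me detM rzR; first by case: i.
apply: (@regular_div _ (m.+1 * e)); rewrite ?detM ?oner_neq0 //.
  exact: dhomog_det.
rewrite map_mxM mulmxA mxE; apply: regular_sum => l _.
rewrite mulSn addnA; apply: regularM => //.
rewrite !mxE; apply: regular_form; rewrite /cofactor -signr_odd mulr_sign.
suff Pd : \det (row' i (col' l M)) \is (m * e).-homog.
  by case: (odd _); rewrite ?dhomogN.
by apply: dhomog_det => i1 j1; rewrite !mxE; apply: Me.
Qed.

End Regularity.

Section DifferenceMatrix.
Variables (R : comNzRingType) (s t : R).

(* u |-> u *m dmx N is (t u_l - s u_{l+1})_l.  With powv N as kernel it presents
   the quotient of O(N)^(N+1) by O as O(N+1)^N: for N = n, this is the pullback
   of the tangent bundle of P^n to the rational normal curve. *)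
Definition dmx N : 'M[R]_(N.+1, N) :=
  \matrix_(i, j) (t *+ (i == j :> nat) - s *+ (i == j.+1 :> nat)).

Definition powv N : 'rV[R]_N.+1 := \row_i (s ^+ (N - i) * t ^+ i).

Lemma mul_dmx N (u : 'rV[R]_N.+1) j :
  (u *m dmx N) 0 j = t * u 0 (widen_ord (leqnSn N) j) - s * u 0 (fintype.lift ord0 j).
Proof.
rewrite mxE (eq_bigr (fun i : 'I_N.+1 => t * u 0 i *+ (i == j :> nat)
    - s * u 0 i *+ (i == j.+1 :> nat))) => [|i _]; last first.
  by rewrite mxE mulrBr !mulrnAr ![_ * u 0 i]mulrC.
rewrite big_split /= sumrN; congr (_ - _).
  rewrite (bigD1 (widen_ord (leqnSn N) j)) //= eqxx big1 ?addr0 // => i neq.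
  rewrite (_ : (i == j :> nat) = false) //.
  by apply: contraNF neq => /eqP ij; apply/eqP/val_inj.
rewrite (bigD1 (fintype.lift ord0 j)) //= eqxx big1 ?addr0 // => i neq.
rewrite (_ : (i == j.+1 :> nat) = false) //.
by apply: contraNF neq => /eqP ij; apply/eqP/val_inj; exact: ij.
Qed.

Lemma powv_dmx N : powv N *m dmx N = 0.
Proof.
apply/matrixP=> i j; rewrite ord1 mul_dmx !mxE /= /bump add1n exprS.
have -> : (N - j = (N - j.+1).+1)%N by have := ltn_ord j; lia.
rewrite exprS; ring.
Qed.

End DifferenceMatrix.

Section DifferenceMatrixField.
Variables (K : fieldType) (s t : K).
Hypothesis s0 : s != 0.

Lemma dmx_ker N (u : 'rV[K]_N.+1) : u *m dmx s t N = 0 ->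
  u = (u 0 ord0 / s ^+ N) *: powv s t N.
Proof.
move=> u0; apply/matrixP=> i j; rewrite ord1 {i} !mxE.
case: j => j ltj; elim: j ltj => [|j IH] ltj.
  rewrite subn0 mulr1 divfK ?expf_neq0 //; congr (u 0 _); exact: val_inj.
have ltj' : (j < N)%N by [].
have /= := IH (ltnW ltj) => IHj.
have := mul_dmx s t u (Ordinal ltj'); rewrite u0 mxE => /esym/eqP.
rewrite subr_eq0 => /eqP E.
have -> : Ordinal ltj = fintype.lift ord0 (Ordinal ltj') by apply: val_inj.
apply: (mulfI s0); rewrite -E.
have -> : widen_ord (leqnSn N) (Ordinal ltj') = Ordinal (ltnW ltj) by apply: val_inj.
rewrite IHj /= (_ : (N - j = (N - j.+1).+1)%N); last by lia.
by rewrite exprS (exprS t); ring.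
Qed.

End DifferenceMatrixField.

Section LocalLift.
Variables (k : fieldType) (p : 'I_2 -> k).
Hypothesis pP : proj_point p.
Local Notation K := (ratfun k).
Local Notation s := (toratfun (hs k)).
Local Notation t := (toratfun (ht k)).

Lemma regular_recursion (a b : {mpoly k[2]}) d (w : nat -> K) :
  a \is 1.-homog -> b \is 1.-homog -> b.@[p] != 0 ->
  (forall j, regular_at d.+1 p (w j)) ->
  exists U : nat -> K, (forall j, regular_at d p (U j)) /\
    forall j, toratfun a * U j - toratfun b * U j.+1 = w j.
Proof.
move=> ah bh b0 wreg; pose U := fix U j :=
  if j is j'.+1 then (toratfun a * U j' - w j') / toratfun b else 0.
exists U; split=> [|j]; last first.
  by rewrite /= [X in _ - X]mulrC divfK ?(meval_neq0 b0) // opprB addrC subrK.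
elim=> [|j IH] /=; first exact: regular0.
apply: (regular_div bh) => //; rewrite addn1; apply: regularB => //.
by rewrite -[d.+1]add1n; apply: regularM => //; apply: regular_form.
Qed.

(** Where s is nonzero at p, the coordinates of u are found in increasing order by dividing by s; at
    s = 0, t is nonzero and they are found in decreasing order by dividing by t. *)
Lemma regular_dmx_lift N d (w : 'rV[K]_N) : (forall j, regular_at d.+1 p (w 0 j)) ->
  exists2 u : 'rV[K]_N.+1, u *m dmx s t N = w & forall j, regular_at d p (u 0 j).
Proof.
move=> wreg.
have hs1 : hs k \is 1.-homog by have := dhomog_hs k 1.
have ht1 : ht k \is 1.-homog by have := dhomog_ht k 1.
pose wn (j : nat) := if insub j is Some i then w 0 i else 0.
have wnE (j : 'I_N) : wn j = w 0 j by rewrite /wn valK.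
have wnreg j : regular_at d.+1 p (wn j).
  by rewrite /wn; case: insub => *; [apply: wreg|apply: regular0].
case: (proj_point2 pP) => [p0|[_ p1]].
  have ps : (hs k).@[p] != 0 by rewrite mevalXU.
  have [U [Ureg UE]] := regular_recursion ht1 hs1 ps wnreg.
  exists (\row_j U j) => [|j]; last by rewrite mxE.
  by apply/rowP => j; rewrite mul_dmx !mxE /= /bump add1n UE wnE.
have pt : (ht k).@[p] != 0 by rewrite mevalXU.
(* Reversing the indices exchanges s and t and changes the sign of the differences. *)
have wnreg' j : regular_at d.+1 p (- wn (N.-1 - j)%N) by apply: regularN.
have [U [Ureg UE]] := regular_recursion hs1 ht1 pt wnreg'.
exists (\row_j U (N - j)%N) => [|j]; last by rewrite mxE.
apply/rowP => j; rewrite mul_dmx !mxE /= /bump add1n -wnE.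
have := UE (N - j.+1)%N.
have -> : (N.-1 - (N - j.+1) = j)%N by have := ltn_ord j; lia.
have -> : ((N - j.+1).+1 = N - j)%N by have := ltn_ord j; lia.
by move/(congr1 -%R); rewrite opprK opprB.
Qed.

End LocalLift.

(** * The pullback of the tangent bundle *)

Lemma mmap_scale (R S : comNzRingType) (phi : {rmorphism R -> S}) n d
    (p : {mpoly R[n]}) (x : 'I_n -> S) c : p \is d.-homog ->
  mmap phi (fun i => c * x i) p = c ^+ d * mmap phi x p.
Proof.
move=> /dhomogP pd; rewrite /mmap mulr_sumr; apply: eq_big_seq => m /pd /= md.
rewrite mulrCA; congr (_ * _); rewrite /mmap1 -md mdegE.
by rewrite -prodrXr -big_split; apply: eq_bigr => i _; rewrite exprMn.
Qed.

Lemma dhomog_mderiv (R : nzRingType) n d (p : {mpoly R[n]}) i :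
  p \is d.+1.-homog -> p^`M(i) \is d.-homog.
Proof.
move=> /dhomogP pd; apply/dhomogP => m; rewrite mcoeff_msupp mcoeff_mderiv => nz.
have /pd /= : (m + U_(i))%MM \in msupp p.
  by rewrite mcoeff_msupp; apply: contraNneq nz => ->; rewrite mul0rn.
by rewrite mdegD mdeg1 addn1 => - [].
Qed.

Lemma castmx_linear (R : nzRingType) m n n' (e : n = n') c (A B : 'M[R]_(m, n)) :
  castmx (erefl m, e) (c *: A + B) = c *: castmx (erefl m, e) A + castmx (erefl m, e) B.
Proof. by case: _ / e; rewrite !castmx_id. Qed.

(* Field identities over an abstract field: [field] does not terminate on the
   concrete field of fractions. *)
Section ChartIdentities.
Variables (K : fieldType) (fi fl fj : K).
Hypotheses (fi0 : fi != 0) (fl0 : fl != 0).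

Lemma chart_change_row vj vl :
  fl * ((fl / fi * vj - fj / fi * vl) / (fl / fi) ^+ 2) =
  fi * vj - fi * vl / fl * fj.
Proof. by field; rewrite fi0 fl0. Qed.

Lemma chart_vectorE uj ui :
  (fi * uj - fj * ui) / fi ^+ 2 = fi^-1 * uj - ui / fi ^+ 2 * fj.
Proof. by field. Qed.

Lemma chart_vector_shift uj ui a :
  fi * (uj + a * fj) - fj * (ui + a * fi) = fi * uj - fj * ui.
Proof. by ring. Qed.

Lemma chart_vector_glue uj ui ul :
  (fl * uj - fj * ul) / fl ^+ 2 =
  (fl / fi * ((fi * uj - fj * ui) / fi ^+ 2)
     - fj / fi * ((fi * ul - fl * ui) / fi ^+ 2)) / (fl / fi) ^+ 2.
Proof. by field; rewrite fi0 fl0. Qed.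

End ChartIdentities.

Section TangentSheaf.
Variables (k : fieldType) (m : nat).
Local Notation K := (ratfun k).
Local Notation T := (@FracField.tofrac {mpoly k[2]}).
Local Notation s := (T (hs k)).
Local Notation t := (T (ht k)).
Local Notation constmx A := (map_mx (fun c : k => T c%:MP) A).

Variables (F : {mpoly k[m.+3]}) (f : m.+3.-tuple {mpoly k[2]}).
Variable B : 'M[k]_m.+3.
Variables (r : 'cV[{mpoly k[2]}]_m.+1) (Z : 'M[{mpoly k[2]}]_(m, m.+1)).
Variable Om : 'M[{mpoly k[2]}]_(m, m.+2).
Hypothesis F_homog : F \is m.+2.-homog.
Hypothesis f_homog : forall i, tnth f i \is m.+2.-homog.
Hypothesis f_neq0 : forall i, tnth f i != 0.
Hypothesis f_base : forall p, proj_point p -> exists i, (tnth f i).@[p] != 0.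
Hypothesis B_unit : B \in unitmx.
Hypothesis r_neq0 : r != 0.
Hypothesis Z_homog : forall i j, Z i j \is m.+3.-homog.
Hypothesis Z_syzygy : Z *m r = 0.
Hypothesis Z_free : forall p, proj_point p -> row_free (map_mx (meval p) Z).
Hypothesis Om_homog : forall i j, Om i j \is m.+2.-homog.

Let fK : 'rV[K]_m.+3 := \row_i T (tnth f i).
Let BK : 'M[K]_m.+3 := constmx B.
Let rK := map_mx T r.
Let ZK := map_mx T Z.
Let OmK := map_mx T Om.
Let D N := dmx s t N.

(* In the coordinates given by B, the curve is the rational normal curve. *)
Hypothesis fB : fK *m BK = powv s t m.+2.
Hypothesis gradF : \col_j T (F^`M(j) \mPo f) = BK *m D m.+2 *m D m.+1 *m rK.
Hypothesis OmZ : OmK *m D m.+1 = ZK.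

Let s0 : s != 0.
Proof. by rewrite tofrac_eq0 -msize_poly_eq0 msizeX. Qed.

Let fK0 i : fK 0 i != 0.
Proof. by rewrite mxE tofrac_eq0. Qed.

Let BK_unit : BK \in unitmx.
Proof. by rewrite (map_unitmx (T \o @mpolyC 2 k)). Qed.

(* The first row has degree m.+1 and generates the image of the tangent bundle of
   P^1, the others have degree m.+2 and lift the generators Z of the normal
   bundle; since the target is O(m.+3), they give O(2) and O(1)^m. *)
Let full : 'M[K]_(1 + m, m.+2) := col_mx (powv s t m.+1) OmK.

Let powv_neq0 N : powv s t N != 0.
Proof.
apply/eqP => /rowP/(_ ord0); rewrite !mxE subn0 mulr1 => /eqP.
by rewrite expf_eq0 (negbTE s0) andbF.
Qed.

(** Independence in one fibre, here at (1 : 1), gives a determinant that is nonzero at that point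
    and so nonzero in k(s, t). *)
Let ZK_free : row_free ZK.
Proof.
have pP : proj_point (fun _ : 'I_2 => 1 : k) by exists ord0; rewrite oner_neq0.
have /row_freeP[R ZR] := Z_free pP.
apply/row_freeP; pose M := Z *m map_mx (@mpolyC 2 k) R.
have detM : \det M != 0.
  suff: (\det M).@[fun=> 1] != 0 by apply: contraNneq => ->; rewrite meval0.
  rewrite -det_map_mx map_mxM -map_mx_comp.
  rewrite (_ : map_mx _ R = R); first by rewrite ZR det1 oner_neq0.
  by apply/matrixP=> i1 j1; rewrite mxE /= mevalC.
exists (map_mx T (map_mx (@mpolyC 2 k) R) *m invmx (map_mx T M)).
have ME : map_mx T M = ZK *m map_mx T (map_mx (@mpolyC 2 k) R) by rewrite map_mxM.
have MU : map_mx T M \in unitmx.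
  by rewrite unitmxE det_map_mx unitfE tofrac_eq0.
by rewrite mulmxA -ME mulmxV.
Qed.

Let full_free : row_free full.
Proof.
rewrite -kermx_eq0; apply/eqP/row_matrixP => i; rewrite row0.
set c : 'rV_(1 + m) := row i _.
have : c *m full = 0 by rewrite -row_mul mulmx_ker row0.
rewrite -[c]hsubmxK mul_row_col => c0.
have cr0 : rsubmx c = 0.
  apply: (row_free_inj ZK_free); rewrite mul0mx -OmZ mulmxA.
  have := congr1 (mulmx^~ (D m.+1)) c0.
  by rewrite mulmxDl -!mulmxA powv_dmx mulmx0 add0r mul0mx.
move: c0; rewrite cr0 mul0mx addr0 => cl0.
rewrite (_ : lsubmx c = 0) ?row_mx0 //.
move: cl0; rewrite {1}[lsubmx c]mx11_scalar mul_scalar_mx => /eqP; rewrite scaler_eq0.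
rewrite (negbTE (powv_neq0 _)) orbF => /eqP c00.
by apply/matrixP => a b; rewrite !ord1 c00 mxE.
Qed.

(** Equality of ranks: the kernel of the nonzero column [rK] has rank m and contains the m
    independent rows of [ZK]. *)
Let ZK_span (z : 'rV[K]_m.+1) : z *m rK = 0 -> (z <= ZK)%MS.
Proof.
move=> zr; have /sub_kermxP zker := zr; apply: (submx_trans zker).
have ZKker : (ZK <= kermx rK)%MS.
  by apply/sub_kermxP; rewrite -map_mxM Z_syzygy map_mx0.
have rk_r : \rank rK = 1%N.
  apply/eqP; rewrite eqn_leq rank_leq_col lt0n mxrank_eq0.
  by apply: contraNneq r_neq0 => /matrixP rK0; apply/eqP/matrixP => i j;
     have /eqP := rK0 i j; rewrite !mxE tofrac_eq0 => /eqP.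
rewrite -(mxrank_leqif_sup ZKker) mxrank_ker rk_r subn1.
by rewrite (eqP ZK_free).
Qed.

Let span (w : 'rV[K]_m.+2) : w *m D m.+1 *m rK = 0 -> (w <= full)%MS.
Proof.
move=> /ZK_span/submxP[c wE].
have /(dmx_ker s0) : (w - c *m OmK) *m D m.+1 = 0.
  by rewrite mulmxBl -mulmxA OmZ wE subrr.
set a := _ / _ => /eqP; rewrite subr_eq => /eqP ->.
apply/submxP; exists (row_mx a%:M c).
by rewrite mul_row_col mul_scalar_mx.
Qed.

Let reg_s p : regular_at 1 p s.
Proof. apply: regular_form; exact: (dhomog_hs k 1). Qed.

Let reg_t p : regular_at 1 p t.
Proof. apply: regular_form; exact: (dhomog_ht k 1). Qed.

(** Multiplying by [D m.+1] kills the first row of [full] and leaves a system in Z for the normal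
    coordinates. Once these are known to be regular, the first coordinate times s^(m+1) and times
    t^(m+1) is regular, and one of the two powers is invertible at p. *)
Let regular_full p (w : 'rV[K]_m.+2) (c : 'rV[K]_(1 + m)) : proj_point p -> w = c *m full ->
  (forall j, regular_at m.+3 p (w 0 j)) ->
  regular_at 2 p (lsubmx c 0 0) /\ forall j, regular_at 1 p (rsubmx c 0 j).
Proof.
move=> pP; rewrite -{1}[c]hsubmxK mul_row_col => wE wreg.
have creg j : regular_at 1 p (rsubmx c 0 j).
  apply: (regular_solve Z_homog (Z_free pP)) => i.
  have <- : w *m D m.+1 = rsubmx c *m ZK.
    by rewrite wE mulmxDl -!mulmxA powv_dmx mulmx0 add0r OmZ.
  rewrite mul_dmx.
  by apply: regularB; apply: regularM; [apply: reg_t|apply: wreg|apply: reg_s|apply: wreg].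
split=> //.
have preg j : regular_at (2 + m.+1) p (lsubmx c 0 0 * powv s t m.+1 0 j).
  have -> : lsubmx c 0 0 * powv s t m.+1 0 j = w 0 j - (rsubmx c *m OmK) 0 j.
    by rewrite wE [in RHS]mxE addrK [lsubmx c]mx11_scalar mul_scalar_mx !mxE eqxx mulr1n.
  apply: regularB => //; rewrite mxE; apply: regular_sum => l _.
  apply: (@regularM _ _ 1 m.+2); first exact: creg.
  by rewrite mxE; apply: regular_form.
move: (lsubmx c 0 0) preg => c0 preg.
have reg_div_pow (b : {mpoly k[2]}) : b \is 1.-homog -> b.@[p] != 0 ->
    regular_at (2 + m.+1) p (c0 * T b ^+ m.+1) -> regular_at 2 p c0.
  move=> bh bp; have b0 : T b ^+ m.+1 != 0 by apply: expf_neq0; apply: (meval_neq0 bp).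
  rewrite -{2}[c0](mulfK b0) -tofracXn; apply: regular_div.
    by have := dhomogMn m.+1 bh; rewrite mul1n.
  by rewrite rmorphXn /= expf_neq0.
case: (proj_point2 pP) => [p0|[_ p1]].
  apply: (reg_div_pow (hs k)); first exact: (dhomog_hs k 1).
    by rewrite mevalXU.
  by have := preg ord0; rewrite mxE subn0 expr0 mulr1.
apply: (reg_div_pow (ht k)); first exact: (dhomog_ht k 1).
  by rewrite mevalXU.
by have := preg ord_max; rewrite mxE subnn expr0 mul1r.
Qed.


Let dF_chartE i j : dF_chart F f i j = T (F^`M(j) \mPo f) / fK 0 i ^+ m.+1.
Proof.
rewrite /dF_chart (_ : mmap _ _ _ =
  mmap (T \o @mpolyC 2 k) (fun j => (fK 0 i)^-1 * T (tnth f j)) F^`M(j)); last first.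
  apply: eq_bigr => mm _; congr (_ * _); apply: mmap1_eq => l.
  by rewrite /chart mulrC mxE.
rewrite (@mmap_scale _ _ _ _ m.+1) ?dhomog_mderiv // exprVn mulrC; congr (_ / _).
rewrite /comp_mpoly /mmap raddf_sum; apply: eq_bigr => mm _ /=.
rewrite tofracM; congr (_ * _); rewrite /mmap1 rmorph_prod.
by apply: eq_bigr => l _; rewrite rmorphXn.
Qed.

Let grad := BK *m D m.+2 *m D m.+1 *m rK.

Let gradE j : grad j 0 = T (F^`M(j) \mPo f).
Proof. by rewrite /grad -gradF mxE. Qed.

Let fK_grad : fK *m grad = 0.
Proof. by rewrite /grad !mulmxA fB powv_dmx !mul0mx. Qed.

Let dF_kernel i (v : 'M[K]_m.+3) :
  \sum_j dF_chart F f i j * v i j = (row i v *m grad) 0 0 / fK 0 i ^+ m.+1.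
Proof.
rewrite mxE mulr_suml; apply: eq_bigr => j _.
by rewrite dF_chartE -gradE mulrAC [_ * v i j]mulrC; congr (_ * _ / _); rewrite mxE.
Qed.

(* The tangent vector f_i * row i v at f, seen in the quotient of K^(n+1) by the
   line of f; it does not depend on the chart i. *)
Let W i (v : 'M[K]_m.+3) := fK 0 i *: (row i v *m BK *m D m.+2).

Let row_glue U v : pullback_tangent F f U v -> forall i l,
  fK 0 l *: row l v = fK 0 i *: row i v - (fK 0 i * v i l / fK 0 l) *: fK.
Proof.
case=> _ _ _ glue _ i l; apply/rowP => j.
rewrite !mxE (glue i l j) // /chart.
by apply: chart_change_row; rewrite tofrac_eq0.
Qed.

Let W_glue U v : pullback_tangent F f U v -> forall i l, W l v = W i v.
Proof.
move=> vE i l; rewrite /W !scalemxAl (row_glue vE i l).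
by rewrite !mulmxBl -!scalemxAl fB powv_dmx scaler0 subr0.
Qed.

Let C v := W ord0 v *m pinvmx full.

Let W_full U v : pullback_tangent F f U v -> W ord0 v = C v *m full.
Proof.
case=> _ _ ker _ _; rewrite /C mulmxKpV //; apply: span.
rewrite (_ : _ *m rK = fK 0 ord0 *: (row ord0 v *m grad)); last first.
  by rewrite /W /grad -!scalemxAl !mulmxA.
have /eqP := ker ord0 (f_neq0 ord0); rewrite dF_kernel mulf_eq0.
rewrite invr_eq0 expf_eq0 (negbTE (fK0 _)) andbF orbF => /eqP g0.
by rewrite [_ *m grad]mx11_scalar g0 scale_scalar_mx mulr0 raddf0.
Qed.

Let regular_constmx p d a b (x : 'M[K]_(1, a)) (A : 'M[k]_(a, b)) :
  (forall j, regular_at d p (x 0 j)) ->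
  forall j, regular_at d p ((x *m constmx A) 0 j).
Proof.
move=> xreg j; rewrite mxE; apply: regular_sum => l _.
rewrite -[d]addn0; apply: regularM => //; rewrite mxE; exact: regular_const.
Qed.

(** By [W_glue] the vector W may be computed in a chart that contains f(p), where the row of v is
    regular. Its degree [m.+3] is that of f_i plus one for the factor s or t in [D]. *)
Let C_reg U v p : proj_point p -> U p -> pullback_tangent F f U v ->
  regular_at 2 p (lsubmx (C v) 0 0) /\ forall j, regular_at 1 p (rsubmx (C v) 0 j).
Proof.
move=> pP Up vE; apply: (regular_full pP (W_full vE)).
have [i fi] := f_base pP; rewrite (W_glue vE i) => j.
rewrite /W [X in regular_at _ _ X]mxE mulrC; apply: (@regularM _ _ 1 m.+2); last first.
  by rewrite mxE; apply: regular_form.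
have vreg l : regular_at 0 p ((row i v *m BK) 0 l).
  by apply: regular_constmx => j'; rewrite mxE; case: vE => + _ _ _ _; apply.
rewrite mul_dmx.
by apply: regularB; apply: (@regularM _ _ 1 0);
   [apply: reg_t|apply: vreg|apply: reg_s|apply: vreg].
Qed.

Let D_full N : row_full (D N).
Proof.
rewrite /row_full eqn_leq rank_leq_col /=.
have : (\rank (kermx (D N)) <= 1)%N.
  apply: leq_trans (mxrankS _) (rank_leq_row (powv s t N)).
  apply/row_subP => i; have : row i (kermx (D N)) *m D N = 0.
    by rewrite -row_mul mulmx_ker row0.
  by move/(dmx_ker s0) ->; apply: scalemx_sub.
by rewrite mxrank_ker leq_subLR addn1 ltnS.
Qed.

Let BKV : constmx (invmx B) *m BK = 1%:M.
Proof.
by rewrite -(map_mx1 (T \o @mpolyC 2 k)) -(mulVmx B_unit) (map_mxM (T \o @mpolyC 2 k)).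
Qed.

Let lift w : 'rV[K]_m.+3 := w *m pinvmx (D m.+2) *m invmx BK.

Let liftK w : lift w *m BK *m D m.+2 = w.
Proof. by rewrite /lift mulmxKV // mulmxKpV // submx_full. Qed.

Let lift_unique (u w : 'rV[K]_m.+3) : u *m BK *m D m.+2 = w *m BK *m D m.+2 ->
  exists a : K, u = w + a *: fK.
Proof.
move=> uw; have /(dmx_ker s0) : (u - w) *m BK *m D m.+2 = 0.
  by rewrite !mulmxBl uw subrr.
set a := _ / _; rewrite -fB => uwa; exists a.
apply/eqP; rewrite addrC -subr_eq; apply/eqP.
by apply: (can_inj (mulmxK BK_unit)); rewrite uwa -scalemxAl.
Qed.

(** Row i is the image of the vector u at f under the differential of x_j / x_i, by the quotient
    rule. *)
Let tangent (u : 'rV[K]_m.+3) : 'M[K]_m.+3 :=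
  \matrix_(i, j) ((fK 0 i * u 0 j - fK 0 j * u 0 i) / fK 0 i ^+ 2).

Let tangent_shift (u : 'rV[K]_m.+3) (a : K) : tangent (u + a *: fK) = tangent u.
Proof. by apply/matrixP => i j; rewrite !mxE chart_vector_shift. Qed.

Let row_tangent u i : row i (tangent u) =
  (fK 0 i)^-1 *: u - (u 0 i / fK 0 i ^+ 2) *: fK.
Proof.
by apply/rowP => j; rewrite !mxE; apply: chart_vectorE; rewrite tofrac_eq0.
Qed.

Let W_tangent u i : W i (tangent u) = u *m BK *m D m.+2.
Proof.
rewrite /W row_tangent !mulmxBl -!scalemxAl fB powv_dmx scaler0 subr0.
rewrite scalerA mulfV; last exact: fK0.
by rewrite scale1r.
Qed.

Let full_grad (c : 'rV[K]_(1 + m)) : c *m full *m D m.+1 *m rK = 0.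
Proof.
rewrite -[c]hsubmxK mul_row_col !mulmxDl -!mulmxA (mulmxA (powv _ _ _)) powv_dmx.
by rewrite mul0mx mulmx0 add0r (mulmxA OmK) OmZ -map_mxM Z_syzygy map_mx0 mulmx0.
Qed.

Let tangent_in (U : ('I_2 -> k) -> Prop) (c : 'rV[K]_(1 + m)) :
  (forall p, U p -> [/\ proj_point p, regular_at 2 p (lsubmx c 0 0) &
     forall j, regular_at 1 p (rsubmx c 0 j)]) ->
  pullback_tangent F f U (tangent (lift (c *m full))).
Proof.
move=> creg; set w := c *m full; split.
- move=> i j p Up fi; have [pP c1 c2] := creg p Up.
  have wreg l : regular_at m.+3 p (w 0 l).
    rewrite /w -[c]hsubmxK mul_row_col mxE; apply: regularD.
      rewrite [lsubmx c]mx11_scalar mul_scalar_mx mxE.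
      apply: (@regularM _ _ 2 m.+1) => //; rewrite mxE -!tofracXn -tofracM.
      apply: regular_form.
      have := dhomogM (dhomog_hs k (m.+1 - l)) (dhomog_ht k l).
      by rewrite subnK // -ltnS.
    rewrite mxE; apply: regular_sum => l' _; apply: (@regularM _ _ 1 m.+2); first exact: c2.
    by rewrite mxE; apply: regular_form.
  (* [lift w] comes from a pseudo-inverse and need not be regular at p. A regular preimage u differs
     from it, after the change of coordinates, by a multiple of [fK], which [tangent] ignores. *)
  have [u uw ureg] := regular_dmx_lift pP wreg.
  pose u' := u *m constmx (invmx B).
  have [|a ->] := @lift_unique (lift w) u'.
    by rewrite liftK /u' -(mulmxA u) BKV mulmx1 uw.
  have u'reg l : regular_at m.+2 p (u' 0 l) by apply: regular_constmx.
  have freg l : regular_at m.+2 p (fK 0 l) by rewrite mxE; apply: regular_form.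
  rewrite tangent_shift [X in regular_at _ _ X]mxE.
  rewrite (_ : fK 0 i ^+ 2 = T (tnth f i ^+ 2)); last by rewrite tofracXn mxE.
  apply: (@regular_div _ _ _ (m.+2 * 2)).
  + exact: dhomogMn.
  + by rewrite rmorphXn /= expf_neq0.
  rewrite add0n muln2 -addnn.
  by apply: regularB; apply: regularM; [apply: freg|apply: u'reg|apply: freg|apply: u'reg].
- by move=> i; rewrite mxE subrr mul0r.
- move=> i _; rewrite dF_kernel row_tangent mulmxBl -!scalemxAl fK_grad scaler0 subr0.
  rewrite (_ : _ *m grad = 0) ?scaler0 ?mxE ?mul0r //.
  by rewrite /grad !mulmxA liftK full_grad.
- move=> i l j fi0 fl0; rewrite !mxE /chart.
  by apply: chart_vector_glue; rewrite tofrac_eq0.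
by move=> i j fi0; have := f_neq0 i; rewrite fi0 eqxx.
Qed.

(** A single map [C], the coordinates of W in the rows of [full], serves for every U, and c |->
    [tangent (lift (c *m full))] is its inverse on sections. The length of [a] equals [1 + m] only
    propositionally, hence the casts. *)
Theorem tangent_sheaf_iso (a : seq nat) : size a = (1 + m)%N ->
  nth 0%N a 0 = 2%N -> (forall j, (j < m)%N -> nth 0%N a j.+1 = 1%N) ->
  sheaf_iso (pullback_tangent F f) (split_bundle k a).
Proof.
move=> sa a0 aS.
have twistE (c : 'rV[K]_(1 + m)) U :
    split_bundle k a U (castmx (erefl, esym sa) c) <->
    (forall p, U p -> regular_at 2 p (lsubmx c 0 0) /\
       forall j, regular_at 1 p (rsubmx c 0 j)).
  split=> [cs p Up|creg j p /creg[c0 cS]].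
    split=> [|j].
      have := cs (cast_ord (esym sa) (lshift m ord0)) p Up.
      by rewrite castmxE esymK cast_ordKV cast_ord_id /= a0 mxE.
    have := cs (cast_ord (esym sa) (rshift 1 j)) p Up.
    by rewrite castmxE esymK cast_ordKV cast_ord_id /= aS // mxE.
  rewrite castmxE esymK cast_ord_id; set j' := cast_ord _ _.
  have -> : nat_of_ord j = j' by [].
  case: (splitP j') => l jl.
    rewrite jl ord1 a0 (_ : j' = lshift m l); last exact: val_inj.
    by move: c0; rewrite mxE ord1.
  rewrite jl aS // (_ : j' = rshift 1 l); last exact: val_inj.
  by have := cS l; rewrite mxE.
exists (fun U v => castmx (erefl, esym sa) (C v)); split; last by [].
move=> U [[S [_ UP]] _].
have projU p : U p -> proj_point p by case/UP.
split.
- move=> v vE; apply/twistE => p Up; apply: C_reg vE => //; exact: projU.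
- move=> y yE; pose c := castmx (erefl, sa) y.
  have yc : y = castmx (erefl, esym sa) c by rewrite castmx_comp castmx_id.
  move: yE; rewrite yc => /twistE creg.
  exists (tangent (lift (c *m full))).
    by apply: tangent_in => p Up; have [] := creg p Up; split=> //; apply: projU.
  congr castmx; rewrite /C W_tangent liftK mulmxKp //.
- move=> v v' vE vE' eqC; have {}eqC : C v = C v'.
    exact: (can_inj (castmxK (erefl 1%N) (esym sa))) eqC.
  have eqW : W ord0 v = W ord0 v' by rewrite (W_full vE) (W_full vE') eqC.
  have eqr0 : row ord0 v = row ord0 v'.
    have [|b rE] := @lift_unique (row ord0 v) (row ord0 v').
      by move: eqW; rewrite /W; apply: (can_inj (scalerK _)); rewrite fK0.
    (* Both diagonal entries are zero and f_0 is not, so the multiple b of [fK] vanishes. *)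
    have /rowP/(_ ord0) := rE; rewrite !mxE.
    case: vE vE' => _ -> _ _ _ [_ -> _ _ _] /esym/eqP.
    have := fK0 ord0; rewrite mxE add0r mulf_eq0 orbC => /negbTE-> /eqP b0.
    by rewrite rE b0 scale0r addr0.
  apply/row_matrixP => l; apply: (can_inj (scalerK (fK0 l))).
  rewrite (row_glue vE ord0) (row_glue vE' ord0) eqr0.
  by have /rowP/(_ l) := eqr0; rewrite !mxE => ->.
- move=> c v v' _ _ _.
  have WE : W ord0 (c *: v + v') = c *: W ord0 v + W ord0 v'.
    by rewrite /W linearP !mulmxDl -!scalemxAl scalerDr !scalerA mulrC.
  by rewrite /C WE mulmxDl -scalemxAl castmx_linear.
Qed.

End TangentSheaf.

(** * Syzygies of binary forms *)

Section Syzygies.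
Variables (k : fieldType) (m : nat).
Implicit Types (r z : 'I_m.+1 -> {poly k}).

Definition syz_map a N r (v : 'rV[k]_(m.+1 * a)) : 'rV[k]_N :=
  poly_rV (\sum_l rVpoly (row l (vec_mx v)) * r l).

Lemma syz_map_is_linear a N r : linear (@syz_map a N r).
Proof.
move=> c u v; rewrite /syz_map -linearP /= scaler_sumr -big_split; congr poly_rV.
by apply: eq_bigr => l _; rewrite !linearP /= mulrDl scalerAl.
Qed.
HB.instance Definition _ a N r :=
  GRing.isLinear.Build k 'rV[k]_(m.+1 * a) 'rV[k]_N _ (@syz_map a N r)
    (@syz_map_is_linear a N r).

(** A Sylvester matrix: the blocks of length [a] hold the coefficients of the z_l, and [poly_rV]
    keeps the first N coefficients of the sum of the z_l r_l. *)
Definition syz_mx a N r : 'M[k]_(m.+1 * a, N) := lin1_mx (@syz_map a N r).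

Lemma mul_syz_mx a N r v : v *m syz_mx a N r = syz_map N r v.
Proof. exact: mul_rV_lin1. Qed.

Definition coef_row a z : 'rV[k]_(m.+1 * a) :=
  mxvec (\matrix_(l < m.+1) poly_rV (z l) : 'M_(m.+1, a)).

Lemma coef_rowK a z : (forall l, size (z l) <= a)%N ->
  forall l, rVpoly (row l (vec_mx (coef_row a z))) = z l.
Proof. by move=> sz l; rewrite mxvecK rowK poly_rV_K. Qed.

Lemma syz_map_coef_row a N r z : (forall l, size (z l) <= a)%N ->
  syz_map N r (coef_row a z) = poly_rV (\sum_l z l * r l).
Proof.
by move=> sz; congr poly_rV; apply: eq_bigr => l _; rewrite coef_rowK.
Qed.

(* For r coming from a hypersurface, the normal bundle of the curve is the bundle
   of syzygies of r; this says that it has no section after a twist by -2. *)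
Definition syz_nondeg r := forall z, (forall l, size (z l) <= m.+3)%N ->
  \sum_l z l * r l = 0 -> forall l, z l = 0.

Lemma det_syz_mx_nondeg r :
  \det (syz_mx m.+3 (m.+1 * m.+3) r) != 0 -> syz_nondeg r.
Proof.
rewrite -unitfE -unitmxE => Mu z sz zr l.
rewrite -(coef_rowK sz l) (_ : coef_row _ _ = 0) ?linear0 ?raddf0 //.
apply: (can_inj (mulmxK Mu)); rewrite mul0mx mul_syz_mx syz_map_coef_row // zr.
by rewrite raddf0.
Qed.

Lemma nondeg_det_syz_mx r : (forall l, size (r l) <= (m.+3 * m).+1)%N ->
  syz_nondeg r -> \det (syz_mx m.+3 (m.+1 * m.+3) r) != 0.
Proof.
move=> sr ndr; rewrite -unitfE -unitmxE -row_free_unit -kermx_eq0.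
apply/eqP/row_matrixP => i; rewrite row0; set v := row i _.
have : v *m syz_mx m.+3 (m.+1 * m.+3) r = 0 by rewrite -row_mul mulmx_ker row0.
pose z l := rVpoly (row l (vec_mx v)).
have sz l : (size (z l) <= m.+3)%N by apply: size_poly.
(* The bound is exactly the number of columns, so [poly_rV] truncates nothing. *)
have szr : (size (\sum_l z l * r l)%R <= m.+1 * m.+3)%N.
  apply: (leq_trans (size_sum _ _ _)); apply/bigmax_leqP => l _.
  apply: (leq_trans (size_polyMleq _ _)).
  have := sz l; have := sr l; lia.
rewrite mul_syz_mx => /(congr1 rVpoly); rewrite /syz_map poly_rV_K // raddf0.
move/(ndr z sz) => z0; rewrite -[v]vec_mxK; apply/eqP.
rewrite (_ : vec_mx v = 0) ?raddf0 //; apply/row_matrixP => l; rewrite row0.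
by rewrite -[row l _]rVpolyK -/(z l) z0 raddf0.
Qed.

Lemma syzygies_exist r : (forall l, size (r l) <= (m.+3 * m).+1)%N ->
  exists zeta : 'I_m -> 'I_m.+1 -> {poly k},
  [/\ forall i l, (size (zeta i l) <= m.+4)%N,
      forall i, \sum_l zeta i l * r l = 0
    & forall c : 'rV[k]_m, (forall l, \sum_i c 0 i *: zeta i l = 0) -> c = 0].
Proof.
(* The values are forms of degree n^2 - 1 with n = m + 2, and the kernel has rank at least (m + 1)(m
   + 4) - (m + 2)^2 = m. *)
move=> sr; pose N := (m.+2 * m.+2)%N; pose M := syz_mx m.+4 N r.
have rkM : (m <= \rank (kermx M))%N.
  rewrite mxrank_ker; have := rank_leq_col M; rewrite /N; lia.
pose P : 'M[k]_(m, m.+1 * m.+4) := pid_mx m *m row_base (kermx M).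
have Pfree : row_free P.
  by rewrite /row_free mxrankMfree ?row_base_free // rank_pid_mx.
have PM : P *m M = 0.
  apply/sub_kermxP; apply: (submx_trans (submxMl _ _)).
  by rewrite eq_row_base.
exists (fun i l => rVpoly (row l (vec_mx (row i P)))); split.
- by move=> i l; apply: size_poly.
- move=> i; have : row i P *m M = 0 by rewrite -row_mul PM row0.
  rewrite mul_syz_mx => /(congr1 rVpoly); rewrite /syz_map poly_rV_K ?raddf0 //.
  apply: (leq_trans (size_sum _ _ _)); apply/bigmax_leqP => l _.
  apply: (leq_trans (size_polyMleq _ _)).
  have := sr l; have : (size (rVpoly (row l (vec_mx (row i P)))) <= m.+4)%N.
    exact: size_poly.
  rewrite /N; lia.
move=> c c0; apply: (row_free_inj Pfree); rewrite mul0mx -[LHS]vec_mxK.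
rewrite (_ : vec_mx _ = 0) ?raddf0 //; apply/row_matrixP => l; rewrite row0.
apply: (can_inj rVpolyK); rewrite raddf0 -(c0 l) mulmx_sum_row !linear_sum /=.
by apply: eq_bigr => i _; rewrite !linearZ.
Qed.

(* A combination of the zeta_i vanishing at p is divisible by the linear form of
   p, and the quotient is a syzygy of r of the degree excluded by [syz_nondeg]. *)
Lemma syzygies_fiber_free r (zeta : 'I_m -> 'I_m.+1 -> {poly k}) p :
  syz_nondeg r -> proj_point p ->
  (forall i l, (size (zeta i l) <= m.+4)%N) ->
  (forall i, \sum_l zeta i l * r l = 0) ->
  (forall c : 'rV[k]_m, (forall l, \sum_i c 0 i *: zeta i l = 0) -> c = 0) ->
  row_free (map_mx (meval p) (\matrix_(i, l) bform m.+3 (zeta i l))).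
Proof.
move=> ndr pP sz zr zfree; rewrite -kermx_eq0; apply/eqP/row_matrixP => i0.
rewrite row0; set c := row i0 _; apply: zfree.
set Zp := map_mx _ _ in c *.
have cZ : c *m Zp = 0 by rewrite -row_mul mulmx_ker row0.
pose xi l := \sum_i c 0 i *: zeta i l.
have sxi l : (size (xi l) <= m.+4)%N.
  apply: (leq_trans (size_sum _ _ _)); apply/bigmax_leqP => i _.
  exact: leq_trans (size_scale_leq _ _) (sz i l).
have xip l : (bform m.+3 (xi l)).@[p] = 0.
  have /rowP/(_ l) := cZ; rewrite !mxE => <-.
  rewrite /xi [X in X.@[p]](linear_sum (bform m.+3)) raddf_sum /=.
  by apply: eq_bigr => i _; rewrite !mxE linearZ /= mevalZ.
have [L L0 facL] := bform_root_factor pP.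
have /fin_all_exists2[Q sQ xiE] l := facL _ _ (sxi l) (xip l).
have Q0 : forall l, Q l = 0.
  apply: ndr => //; apply: (mulIf L0); rewrite mul0r mulr_suml.
  transitivity (\sum_i c 0 i *: \sum_l zeta i l * r l); last first.
    by apply: big1 => i _; rewrite zr scaler0.
  under [RHS]eq_bigr do rewrite scaler_sumr.
  rewrite exchange_big; apply: eq_bigr => l _ /=.
  rewrite mulrAC -xiE mulr_suml; apply: eq_bigr => i _.
  by rewrite scalerAl.
by move=> l; rewrite -/(xi l) xiE Q0 mul0r.
Qed.

End Syzygies.

(** Global counterpart of [regular_dmx_lift]: the kernel of [dmx] on O(e)^(N+1) is O(e - N), whose
    H^1 vanishes exactly when e - N >= -1. *)
Lemma poly_dmx_lift (k : fieldType) N e (y : 'rV[{poly k}]_N) : (N <= e.+1)%N ->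
  (forall l, (size (y 0%R l) <= e.+2)%N) ->
  exists2 x : 'rV[{poly k}]_N.+1, x *m dmx 1 'X N = y &
    forall i, (size (x 0%R i) <= e.+1)%N.
Proof.
move=> leNe sy.
have lift1 l : exists x : 'rV[{poly k}]_N.+1, x *m dmx 1 'X N = y 0 l *: delta_mx 0 l /\
    forall i, (size (x 0%R i) <= e.+1)%N.
  have [al [be [yE sal sbe]]] : exists al be : {poly k},
      [/\ y 0 l = be + 'X^(l.+1) * al, (size al <= e.+1 - l)%N & (size be <= l.+1)%N].
    exists (drop_poly l.+1 (y 0 l)), (take_poly l.+1 (y 0 l)).
    rewrite mulrC poly_take_drop size_drop_poly size_take_poly; split=> //.
    have := sy l; lia.
  (* Consecutive entries on the same side of l have difference 0. The jump at l is X^(l+1) al + be,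
     and cutting y_l at X^(l+1) keeps both sides within the degree. *)
  exists (\row_i if (i <= l)%N then 'X^i * al else - ('X^(i - l.+1) * be)); split=> [|i].
    apply/rowP => j; rewrite mul_dmx !mxE /= /bump add1n mul1r.
    have [jl|lj|jl] := ltngtP j l.
    - rewrite mulrA -exprS subrr (_ : (j == l) = false) ?mulr0 //.
      by apply/eqP => E; move: jl; rewrite E ltnn.
    - rewrite (_ : (j == l) = false) ?mulr0; last by apply/eqP => E; move: lj; rewrite E ltnn.
      by rewrite mulrN opprK mulrA -exprS -subSn // addNr.
    rewrite jl subnn expr0 mul1r opprK mulrA -exprS yE addrC.
    by rewrite (_ : (j == l) = true) ?mulr1 //; apply/eqP/val_inj.
  rewrite mxE; case: (leqP i l) => il.
    apply: (leq_trans (size_polyMleq _ _)); rewrite size_polyXn addSn /=.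
    by apply: (leq_trans (leq_add il sal)); rewrite subnKC // (leq_trans _ leNe) // ltnW.
  rewrite size_polyN; apply: (leq_trans (size_polyMleq _ _)).
  rewrite size_polyXn addSn /=; apply: (leq_trans (leq_add (leqnn _) sbe)).
  by rewrite subnK // (leq_trans _ leNe) // -ltnS.
have [X XP] := fin_all_exists lift1.
exists (\sum_l X l) => [|i].
  rewrite mulmx_suml [RHS]row_sum_delta; apply: eq_bigr => l _.
  by case: (XP l).
rewrite summxE; apply: (leq_trans (size_sum _ _ _)); apply/bigmax_leqP => l _.
by case: (XP l).
Qed.

(** * Hypersurfaces through a rational normal curve *)

Section Composition.
Variable R : comNzRingType.

Lemma comp_mpolyA n1 n2 n3 (p : {mpoly R[n1]}) (lq : n1.-tuple {mpoly R[n2]})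
    (lr : n2.-tuple {mpoly R[n3]}) :
  (p \mPo lq) \mPo lr = p \mPo [tuple tnth lq i \mPo lr | i < n1].
Proof.
elim/mpoly_ring_ind: p => [c|i|p q IHp IHq|p q IHp IHq]; rewrite ?comp_mpolyC //.
- by rewrite !comp_mpolyXU -!tnth_nth tnth_mktuple.
- by rewrite !comp_mpolyD IHp IHq.
by rewrite !rmorphM /= IHp IHq.
Qed.

Lemma mderiv_comp_mpoly n1 n2 (p : {mpoly R[n1]}) (lq : n1.-tuple {mpoly R[n2]}) i :
  (p \mPo lq)^`M(i) = \sum_j (tnth lq j)^`M(i) * (p^`M(j) \mPo lq).
Proof.
elim/mpoly_ring_ind: p => [c|l|p q IHp IHq|p q IHp IHq].
- rewrite comp_mpolyC mderivC big1 // => j _.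
  by rewrite mderivC comp_mpoly0 mulr0.
- rewrite comp_mpolyXU -tnth_nth (bigD1 l) //= big1 => [|j neq].
    by rewrite mderivXU eqxx comp_mpoly1 mulr1 addr0.
  by rewrite mderivXU eq_sym (negbTE neq) comp_mpoly0 mulr0.
- rewrite comp_mpolyD mderivD IHp IHq -big_split; apply: eq_bigr => j _ /=.
  by rewrite mderivD comp_mpolyD mulrDr.
rewrite rmorphM /= mderivM IHp IHq mulr_suml mulr_sumr -big_split.
apply: eq_bigr => j _ /=; rewrite mderivM comp_mpolyD !rmorphM /=; ring.
Qed.

Lemma dhomog_comp_mpoly n1 n2 d e (p : {mpoly R[n1]}) (lq : n1.-tuple {mpoly R[n2]}) :
  p \is d.-homog -> (forall i, tnth lq i \is e.-homog) -> p \mPo lq \is (d * e).-homog.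
Proof.
move=> /dhomogP pd lqe; rewrite comp_mpolyEX big_seq; apply: rpred_sum => m /pd /= md.
apply: dhomogZ; rewrite comp_mpolyX -md mdegE big_distrl /=.
elim/big_rec2: _ => [|i y1 y2 _ IH]; first exact: dhomog1.
by apply: dhomogM => //; rewrite mulnC; apply: dhomogMn.
Qed.

End Composition.

Section BinaryDifference.
Variable k : fieldType.
Local Notation X := ('X : {poly k}).

Lemma bformX : bform 1 X = ht k.
Proof. by rewrite -['X]expr1 bformXn // subnn expr0 mul1r expr1. Qed.

Lemma bform1 : bform 1 (1 : {poly k}) = hs k.
Proof. by rewrite -[1](expr0 'X) bformXn // expr0 mulr1 subn0 expr1. Qed.

Lemma bform_dmx N i j : bform 1 (dmx 1 X N i j) = dmx (hs k) (ht k) N i j.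
Proof. by rewrite !mxE linearB /= !raddfMn /= bformX bform1. Qed.

Lemma size_dmx N i j : (size (dmx 1 X N i j) <= 2)%N.
Proof.
rewrite mxE; apply: (leq_trans (size_polyD _ _)); rewrite size_polyN geq_max.
by case: eqP => _; case: eqP => _; rewrite ?mulr1n ?mulr0n ?size_poly0 ?size_polyX ?size_poly1.
Qed.

Lemma size_dmx_col N e (c : 'cV[{poly k}]_N) : (forall j, size (c j ord0) <= e.+1)%N ->
  forall i, (size ((dmx 1 X N *m c) i ord0) <= e.+2)%N.
Proof.
move=> sc i; rewrite mxE; apply: (leq_trans (size_sum _ _ _)).
apply/bigmax_leqP => j _; apply: (leq_trans (size_polyMleq _ _)).
have := leq_add (size_dmx i j) (sc j); rewrite add2n.
by case: (_ + _)%N.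
Qed.

Lemma bform_dmx_col N e (c : 'cV[{poly k}]_N) : (forall j, size (c j ord0) <= e.+1)%N ->
  map_mx (bform e.+1) (dmx 1 X N *m c) = dmx (hs k) (ht k) N *m map_mx (bform e) c.
Proof.
move=> sc; apply/matrixP => i j; rewrite ord1 mxE [in LHS]mxE [in RHS]mxE.
rewrite (linear_sum (bform e.+1)); apply: eq_bigr => l _ /=.
by rewrite -bform_dmx [map_mx (bform e) c l _]mxE bformM // size_dmx.
Qed.

Lemma bform_dmx_row N e (x : 'rV[{poly k}]_N.+1) :
  (forall i, size (x ord0 i) <= e.+1)%N ->
  map_mx (bform e.+1) (x *m dmx 1 X N) = map_mx (bform e) x *m dmx (hs k) (ht k) N.
Proof.
move=> sx; apply/matrixP => i j; rewrite ord1 mxE [in LHS]mxE [in RHS]mxE.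
rewrite (linear_sum (bform e.+1)); apply: eq_bigr => l _ /=.
by rewrite -bform_dmx [map_mx (bform e) x _ l]mxE bformM ?size_dmx // addn1.
Qed.

Lemma map_dmx (R S : comNzRingType) (phi : {rmorphism R -> S}) s t N :
  map_mx phi (dmx s t N) = dmx (phi s) (phi t) N.
Proof. by apply/matrixP => i j; rewrite !mxE rmorphB !rmorphMn. Qed.

End BinaryDifference.

Definition linear_comp (R : comNzRingType) n (B : 'M[R]_n) (G : {mpoly R[n]}) :
    {mpoly R[n]} :=
  G \mPo [tuple \sum_i B i j *: 'X_i | j < n].

Section RationalNormalCurve.
Variables (k : fieldType) (m : nat).
Local Notation n := m.+2.

Definition rnc : n.+1.-tuple {mpoly k[2]} := [tuple bform n 'X^i | i < n.+1].

Definition rnc_eval (p : {mpoly k[n.+1]}) : {poly k} :=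
  mmap polyC (fun i : 'I_n.+1 => 'X^i) p.

Lemma dehom_comp_rnc p : dehom (p \mPo rnc) = rnc_eval p.
Proof.
elim/mpoly_ring_ind: p => [c|i|p q IHp IHq|p q IHp IHq].
- by rewrite comp_mpolyC /dehom /rnc_eval !mmapC.
- rewrite comp_mpolyXU -tnth_nth tnth_mktuple bformK ?size_polyXn //.
  by rewrite /rnc_eval mmapX mmap1U.
- by rewrite comp_mpolyD [LHS]mmapD [RHS]mmapD; congr (_ + _).
by rewrite rmorphM [LHS]rmorphM [RHS]rmorphM; congr (_ * _).
Qed.

Lemma comp_rncE d p : p \is d.-homog -> p \mPo rnc = bform (d * n) (rnc_eval p).
Proof.
move=> pd; rewrite -dehom_comp_rnc dehomK //; apply: dhomog_comp_mpoly => // i.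
by rewrite tnth_mktuple dhomog_bform.
Qed.

(** [linear_comp B] composes with x |-> x B on row vectors, so the curve is moved by the inverse
    matrix. *)
Definition rnc_transform (B : 'M[k]_n.+1) : n.+1.-tuple {mpoly k[2]} :=
  [tuple \sum_l invmx B l i *: tnth rnc l | i < n.+1].

Variables (B : 'M[k]_n.+1) (G : {mpoly k[n.+1]}) (r : 'I_m.+1 -> {poly k}).
Hypothesis B_unit : B \in unitmx.
Hypothesis G_homog : G \is n.-homog.
Hypothesis size_r : (forall l, size (r l) <= (m.+3 * m).+1)%N.
Hypothesis r_nondeg : syz_nondeg r.
Hypothesis grad_G : \col_j rnc_eval G^`M(j) =
  dmx 1 'X n *m (dmx 1 'X m.+1 *m \col_l r l).

Let F := linear_comp B G.
Let f := rnc_transform B.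

Let f_homog i : tnth f i \is n.-homog.
Proof.
rewrite tnth_mktuple; apply: rpred_sum => l _; apply: rpredZ.
by rewrite tnth_mktuple dhomog_bform.
Qed.

Lemma rnc_transform_morphism : P1_morphism n f.
Proof.
split=> // p pP; have [i fi|f0] := pickP (fun i => (tnth f i).@[p] != 0).
  by exists i.
pose f0p : 'rV_n.+1 := \row_l (tnth rnc l).@[p].
have f0p0 : f0p = 0.
  apply: (can_inj (mulmxK (_ : invmx B \in unitmx))); first by rewrite unitmx_inv.
  rewrite mul0mx; apply/rowP => i; rewrite [LHS]mxE [RHS]mxE.
  transitivity (tnth f i).@[p]; last by apply/eqP/negbFE/f0.
  rewrite [tnth f i]tnth_mktuple raddf_sum.
  by apply: eq_bigr => l _; rewrite /= mevalZ mxE mulrC.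
have powE (l : 'I_n.+1) : p ord0 ^+ (n - l) * p ord_max ^+ l = 0.
  have ln : (l <= n)%N by rewrite -ltnS.
  have /rowP/(_ l) := f0p0; rewrite !mxE tnth_mktuple bformXn // => <-.
  by rewrite mevalM !rmorphXn /= !mevalXU.
exfalso; case: (proj_point2 pP) => [p0|[_ p1]].
  by have /eqP := powE ord0; rewrite subn0 mulr1 expf_eq0 (negbTE p0).
by have /eqP := powE ord_max; rewrite subnn mul1r expf_eq0 (negbTE p1).
Qed.

Let sum_f j : \sum_i B i j *: tnth f i = tnth rnc j.
Proof.
transitivity (\sum_l (invmx B *m B) l j *: tnth rnc l).
  under [RHS]eq_bigr do rewrite mxE scaler_suml.
  rewrite exchange_big; apply: eq_bigr => i _ /=.
  rewrite tnth_mktuple scaler_sumr.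
  by apply: eq_bigr => l _; rewrite scalerA mulrC.
rewrite mulVmx // (bigD1 j) //= mxE eqxx scale1r big1 ?addr0 // => l neq.
by rewrite mxE (negbTE neq) scale0r.
Qed.

Let subst_f : [tuple tnth [tuple \sum_i B i j *: 'X_i | j < n.+1] i \mPo f | i < n.+1]
  = rnc.
Proof.
apply: eq_from_tnth => j; rewrite tnth_mktuple tnth_mktuple raddf_sum -sum_f.
by apply: eq_bigr => i _ /=; rewrite comp_mpolyZ comp_mpolyXU -tnth_nth.
Qed.

Lemma comp_rnc_transform p : linear_comp B p \mPo f = p \mPo rnc.
Proof. by rewrite /linear_comp comp_mpolyA subst_f. Qed.

Lemma rnc_transform_lies_on : rnc_eval G = 0 -> lies_on f F.
Proof. by move=> G0; rewrite /lies_on comp_rnc_transform (comp_rncE G_homog) G0 raddf0. Qed.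

Lemma dhomog_linear_comp : F \is n.-homog.
Proof.
rewrite -[n in n.-homog]muln1; apply: dhomog_comp_mpoly => // i.
rewrite tnth_mktuple; apply: rpred_sum => l _; apply: rpredZ.
by rewrite dhomogX /= mdeg1.
Qed.

Let grad_linear_comp i :
  F^`M(i) \mPo f = \sum_l (B i l)%:MP * (G^`M(l) \mPo rnc).
Proof.
rewrite /F mderiv_comp_mpoly [LHS]raddf_sum /=; apply: eq_bigr => l _.
rewrite rmorphM /= comp_mpolyA subst_f; congr (_ * _).
rewrite tnth_mktuple (big_morph _ (mderivD i) (mderiv0 _ i)) (bigD1 i) //= big1.
  by rewrite mderivZ mderivXU eqxx addr0 comp_mpolyZ comp_mpoly1 alg_mpolyC.
by move=> i' neq; rewrite mderivZ mderivXU (negbTE neq) scaler0.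
Qed.

Let grad_F : \col_j toratfun (F^`M(j) \mPo f) =
  map_mx (fun c : k => toratfun c%:MP) B *m
  dmx (toratfun (hs k)) (toratfun (ht k)) n *m
  dmx (toratfun (hs k)) (toratfun (ht k)) m.+1 *m
  map_mx (@FracField.tofrac {mpoly k[2]}) (\col_l bform (m.+3 * m) (r l)).
Proof.
have sr j : (size ((\col_l r l) j ord0) <= (m.+3 * m).+1)%N by rewrite mxE.
have gradK : \col_j (G^`M(j) \mPo rnc) =
    dmx (hs k) (ht k) n *m (dmx (hs k) (ht k) m.+1 *m \col_l bform (m.+3 * m) (r l)).
  rewrite (_ : \col_l bform _ _ = map_mx (bform (m.+3 * m)) (\col_l r l)); last first.
    by apply/matrixP => i j; rewrite !mxE.
  rewrite -(bform_dmx_col sr) -(bform_dmx_col (size_dmx_col sr)) -grad_G.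
  apply/matrixP => i j; rewrite !mxE (@comp_rncE m.+1) ?dhomog_mderiv //.
  by congr bform; lia.
rewrite -!(mulmxA (map_mx _ B)) -(mulmxA (dmx _ _ _)).
rewrite -!map_dmx -!map_mxM -gradK; apply/matrixP => i j; rewrite !mxE.
rewrite grad_linear_comp raddf_sum; apply: eq_bigr => l _ /=.
by rewrite !mxE tofracM.
Qed.

Theorem rnc_transform_tangent :
  sheaf_iso (pullback_tangent F f) (split_bundle k (2%N :: nseq (n - 2) 1%N)).
Proof.
have [zeta [sz zr zfree]] := syzygies_exist size_r.
have lift_zeta i : exists x : 'rV[{poly k}]_m.+2,
    x *m dmx 1 'X m.+1 = \row_l zeta i l /\ forall j, (size (x ord0 j) <= m.+3)%N.
  have [||x xE sx] := @poly_dmx_lift k m.+1 m.+2 (\row_l zeta i l).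
  - by rewrite ltnS leqW.
  - by move=> l; rewrite mxE.
  by exists x.
have {lift_zeta}[om omP] := fin_all_exists lift_zeta.
pose Z := \matrix_(i < m, l < m.+1) bform m.+3 (zeta i l).
pose Om := \matrix_(i < m, l < m.+2) bform m.+2 (om i ord0 l).
pose rc := \col_(l < m.+1) bform (m.+3 * m) (r l).
apply: (@tangent_sheaf_iso k m F f B rc Z Om) => //.
- exact: dhomog_linear_comp.
- move=> i; rewrite tnth_mktuple.
  rewrite (_ : \sum_l _ = bform n (\poly_(l < n.+1) invmx B (inord l) i)).
    apply/eqP => /(bform_eq0 (size_poly _ _))/polyP coef0.
    have /rowP/(_ i) : row i (B *m invmx B)^T = 0.
      apply/rowP => j; rewrite mulmxE; rewrite !mxE big1 // => l _.
      have := coef0 l; rewrite coef_poly ltn_ord inord_val coefC => ->.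
      by case: (l == 0 :> nat); rewrite mulr0.
    by rewrite mulmxV // !mxE eqxx => /eqP; rewrite oner_eq0.
  rewrite poly_def linear_sum; apply: eq_bigr => l _ /=.
  by rewrite linearZ inord_val tnth_mktuple.
- by case: rnc_transform_morphism.
(* If r were zero, the constant vector 1 would be a syzygy excluded by [r_nondeg]. *)
- apply/eqP => rc0; have : forall l : 'I_m.+1, (1 : {poly k}) = 0.
    apply: (r_nondeg (z := fun=> 1)) => [l|]; first by rewrite size_poly1.
    apply: big1 => l _; rewrite mul1r; apply: (bform_eq0 (size_r l)).
    by have /matrixP/(_ l ord0) := rc0; rewrite !mxE.
  by move/(_ ord0)/eqP; rewrite oner_eq0.
- by move=> i j; rewrite mxE dhomog_bform.
- apply/matrixP => i j; rewrite ord1 !mxE.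
  transitivity (bform (m.+3 + m.+3 * m) (\sum_l zeta i l * r l)).
    rewrite linear_sum; apply: eq_bigr => l _ /=.
    by rewrite !mxE bformM.
  by rewrite zr raddf0.
- by move=> p pP; apply: (syzygies_fiber_free r_nondeg).
- by move=> i j; rewrite mxE dhomog_bform.
- apply/rowP => j; rewrite [RHS]mxE -!tofracXn -tofracM -bformXn; last by rewrite -ltnS.
  rewrite -[bform _ _](tnth_mktuple (fun i : 'I_n.+1 => bform n 'X^i)) -/rnc -sum_f.
  rewrite raddf_sum mxE; apply: eq_bigr => i _ /=.
  by rewrite !mxE -tofracM mulrC mul_mpolyC.
- apply/row_matrixP => i; have [omE som] := omP i.
  rewrite row_mul -!map_row -map_dmx -map_mxM; congr map_mx.
  have -> : row i Om = map_mx (bform n) (om i).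
    by apply/rowP => l; rewrite !mxE.
  rewrite -(bform_dmx_row som) omE.
  by apply/rowP => l; rewrite !mxE.
- by rewrite /= size_nseq; lia.
- by move=> j ltj; rewrite /= nth_nseq; case: ltnP => //; lia.
Qed.

End RationalNormalCurve.

(** * Expansions in base X^K and gradients of binomials along the curve *)

Section Chunks.
Variable (k : fieldType).
Implicit Types P : {poly k}.

(** Digits in base X^K, except that the last one takes the e remaining coefficients. *)
Lemma chunks_exist K e L P : (K <= e)%N -> (size P <= K * L + e)%N ->
  exists z : 'I_L.+1 -> {poly k},
    (forall l, (size (z l) <= e)%N) /\ \sum_l z l * 'X^(K * l) = P.
Proof.
move=> Ke; elim: L P => [|L IH] P sP.
  exists (fun=> P); split=> [_|]; first by rewrite muln0 in sP.
  by rewrite big_ord1 muln0 mulr1.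
have [|z [sz zP]] := IH (drop_poly K P).
  by rewrite size_drop_poly leq_subLR addnA -mulnS.
exists (fun l => if unlift ord0 l is Some l' then z l' else take_poly K P); split.
  move=> l; case: unliftP => [l' _|_]; first exact: sz.
  exact: leq_trans (size_take_poly _ _) Ke.
rewrite big_ord_recl unlift_none muln0 mulr1 -[RHS](poly_take_drop K) -zP mulr_suml.
congr (_ + _); apply: eq_bigr => l _.
by rewrite liftK /= /bump add1n mulnS -mulrA -exprD addnC.
Qed.

Lemma chunks_unique K L (z : 'I_L -> {poly k}) : (forall l, (size (z l) <= K)%N) ->
  \sum_l z l * 'X^(K * l) = 0 -> forall l, z l = 0.
Proof.
elim: L z => [|L IH] z sz; first by move=> _ [].
rewrite big_ord_recl muln0 mulr1.
rewrite (eq_bigr (fun l : 'I_L => z (fintype.lift ord0 l) * 'X^(K * l) * 'X^K))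
  => [|l _]; last first.
  by rewrite /= /bump add1n mulnS -mulrA -exprD addnC.
rewrite -mulr_suml => E.
have z0 : z ord0 = 0.
  have := congr1 (take_poly K) E.
  by rewrite take_polyD take_polyMXn_0 addr0 take_poly_id // raddf0.
move/eqP: E; rewrite z0 add0r mulf_eq0 expf_eq0 polyX_eq0 andbF orbF => /eqP.
move/(IH _ (fun l => sz _)) => zS l.
by case: (unliftP ord0 l) => [l' ->|->]; [apply: zS|].
Qed.

End Chunks.

Section BinomialGradient.
Variables (k : fieldType) (m : nat).
Local Notation n := m.+2.
Implicit Types (mu nu : 'X_{1..n.+1}).

Definition weight mu := (\sum_(l < n.+1) mu l * l)%N.

Lemma rnc_evalX mu : rnc_eval 'X_[mu] = 'X^(weight mu) :> {poly k}.
Proof.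
rewrite /rnc_eval mmapX /mmap1 -prodrXr; apply: eq_bigr => l _.
by rewrite -exprM mulnC.
Qed.

(* The gradient of 'X_[mu] on the curve is (mu_j t^(w - j))_j, with s = 1 and w the
   weight of mu; the partial weights are the second antidifference of j |-> mu_j,
   which is what inverting dmx twice requires.  The truncated subtractions are
   harmless since the coefficient of [binom_syz] vanishes when they occur. *)
Definition partial_weight (a : nat) mu := (\sum_(l < n.+1) mu l * (a - l))%N.

Definition binom_syz mu nu (a : nat) : {poly k} :=
  ((partial_weight a mu)%:R - (partial_weight a nu)%:R) *: 'X^(weight mu - a.+1).

Lemma partial_weight_full a mu : (forall l, mu l != 0%N -> (l <= a)%N) ->
  (partial_weight a mu + weight mu = a * mdeg mu)%N.
Proof.
move=> supp; rewrite mdegE big_distrr -big_split; apply: eq_bigr => l _ /=.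
have [->|/supp la] := eqVneq (mu l) 0%N; first by rewrite !mul0n muln0.
by rewrite -mulnDr subnK // mulnC.
Qed.

Lemma leq_weight mu l : mu l != 0%N -> (l <= weight mu)%N.
Proof.
move=> mul; rewrite /weight (bigD1 l) //=; apply: (leq_trans _ (leq_addr _ _)).
by rewrite leq_pmull // lt0n.
Qed.

Lemma weight_leq mu l : mu l != 0%N -> (weight mu <= l + n * (mdeg mu).-1)%N.
Proof.
move=> mul; rewrite /weight mdegE (bigD1 l) //= [X in (n * X.-1)%N](bigD1 l) //=.
rewrite -lt0n in mul; case: (mu l) mul => // e _; rewrite mulSn -addnA leq_add2l.
rewrite addSn /= mulnDr leq_add //; first by rewrite mulnC leq_mul // -ltnS.
rewrite big_distrr leq_sum // => i _; rewrite mulnC leq_mul //.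
by rewrite -ltnS.
Qed.

Lemma partial_weight0 a mu : (forall l, mu l != 0%N -> (a <= l)%N) ->
  partial_weight a mu = 0%N.
Proof.
move=> supp; apply: big1 => l _; have [->|/supp] := eqVneq (mu l) 0%N; first by [].
by rewrite -subn_eq0 => /eqP ->; rewrite muln0.
Qed.

(** The second difference of a |-> max(a - l, 0) is 1 at a = l and 0 elsewhere. *)
Lemma partial_weight_rec a mu (j : 'I_n.+1) : nat_of_ord j = a ->
  (partial_weight a.+1 mu + partial_weight a.-1 mu =
   (partial_weight a mu).*2 + mu j)%N.
Proof.
move=> ja; rewrite -addnn /partial_weight -!big_split /=.
rewrite [LHS](bigD1 j) // [in RHS](bigD1 j) //= ja subnn muln0.
rewrite subSnn muln1 (_ : (a.-1 - a = 0)%N) ?muln0 ?addn0; last by lia.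
rewrite addnC add0n; congr (_ + _)%N; apply: eq_bigr => l lj.
rewrite -!mulnDr; congr (_ * _)%N.
have : nat_of_ord l <> a by rewrite -ja => /val_inj E; rewrite E eqxx in lj.
lia.
Qed.

Variables (mu nu : 'X_{1..n.+1}).
Hypotheses (deg_mu : mdeg mu = n) (deg_nu : mdeg nu = n).
Hypothesis weight_eq : weight mu = weight nu.

(** Without truncation, the partial weight is [a] times the degree minus the weight, hence the same
    for mu and nu. *)
Lemma binom_syz0 a : (forall l, mu l != 0%N -> (l <= a)%N) ->
  (forall l, nu l != 0%N -> (l <= a)%N) -> binom_syz mu nu a = 0.
Proof.
move=> /partial_weight_full Em /partial_weight_full En.
rewrite /binom_syz (_ : partial_weight a mu = partial_weight a nu) ?subrr ?scale0r //.
by apply: (@addIn (weight mu)); rewrite [in RHS]weight_eq Em En deg_mu deg_nu.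
Qed.

Lemma binom_syz_large a : (n <= a)%N -> binom_syz mu nu a = 0.
Proof.
by move=> na; apply: binom_syz0 => l _; apply: leq_trans na; rewrite -ltnS.
Qed.

Lemma binom_syz_origin : binom_syz mu nu 0 = 0.
Proof. by rewrite /binom_syz !partial_weight0 ?subrr ?scale0r. Qed.

(** A weight of at least n(n-1) + a forces every index occurring in mu or nu to be at least a, so
    both partial weights vanish. For smaller weights the exponent is at most n(n-1) - 2 =
    (n+1)(n-2). *)
Lemma size_binom_syz a : (size (binom_syz mu nu a) <= (m.+3 * m).+1)%N.
Proof.
have [wa|wa] := leqP (weight mu) (n * n.-1 + a).-1.
  apply: (leq_trans (size_scale_leq _ _)); rewrite size_polyXn ltnS.
  by move: wa; rewrite /=; lia.
have supp xi : mdeg xi = n -> weight xi = weight mu -> partial_weight a xi = 0%N.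
  move=> dx wx; apply: partial_weight0 => l /weight_leq; rewrite dx wx.
  by move: wa; rewrite /=; lia.
by rewrite /binom_syz !supp // subrr scale0r size_poly0.
Qed.

Lemma mulX_binom_syz a : 'X * binom_syz mu nu a =
  ((partial_weight a mu)%:R - (partial_weight a nu)%:R) *: 'X^(weight mu - a).
Proof.
have [wa|wa] := leqP (weight mu) a; last first.
  by rewrite /binom_syz -scalerAr -exprS -subSn // subSS.
have b0 : binom_syz mu nu a = 0.
  by apply: binom_syz0 => l /leq_weight; rewrite -?weight_eq => /leq_trans; apply.
rewrite b0 mulr0; move/eqP: b0; rewrite scaler_eq0 expf_eq0 polyX_eq0 andbF orbF.
by move/eqP->; rewrite scale0r.
Qed.

Lemma rnc_eval_binom_deriv (j : 'I_n.+1) : rnc_eval ('X_[mu] - 'X_[nu])^`M(j) =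
  ((mu j)%:R - (nu j)%:R) *: 'X^(weight mu - j) :> {poly k}.
Proof.
have derX xi : rnc_eval 'X_[xi]^`M(j) = (xi j)%:R *: 'X^(weight xi - j) :> {poly k}.
  rewrite mderivX /rnc_eval mmapZ mul_polyC -/(rnc_eval _) rnc_evalX.
  have [->|xij] := eqVneq (xi j) 0%N; first by rewrite !scale0r.
  congr (_ *: 'X^_); rewrite /weight !(bigD1 j (P := predT)) //= mnmBE mnm1E eqxx.
  rewrite (eq_bigr (fun l : 'I_n.+1 => xi l * l)%N) => [|l lj]; last first.
    by rewrite mnmBE mnm1E eq_sym (negbTE lj) subn0.
  rewrite mulnBl mul1n addnBAC // leq_pmull // lt0n //.
rewrite mderivB [LHS]mmapB -!/(rnc_eval _) !derX weight_eq scalerBl.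
by [].
Qed.

Lemma mul_dmx_col N (g : nat -> {poly k}) : g 0%N = 0 -> g N.+1 = 0 ->
  dmx 1 'X N *m (\col_(l < N) g l.+1) = \col_(i < N.+1) ('X * g i.+1 - g i).
Proof.
move=> g0 gN; apply/matrixP => i j; rewrite ord1 mxE [RHS]mxE.
rewrite (eq_bigr (fun l : 'I_N => ('X * g l.+1) *+ (i == l :> nat)
    - g l.+1 *+ (i == l.+1 :> nat))) => [|l _]; last first.
  by rewrite !mxE mulrBl !mulrnAl mul1r.
rewrite big_split /= sumrN; congr (_ - _).
  have [iN|iN] := ltnP i N.
    rewrite (bigD1 (Ordinal iN)) //= eqxx big1 ?addr0 // => l neq.
    rewrite (_ : (i == l :> nat) = false) //; apply: contraNF neq => /eqP il.
    by apply/eqP/val_inj.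
  have -> : nat_of_ord i = N by apply/eqP; rewrite eqn_leq iN -ltnS ltn_ord.
  rewrite gN mulr0 big1 // => l _; case: eqP => // E.
  by have := ltn_ord l; rewrite -E ltnn.
case: i => [[|i] lti] /=; first by rewrite g0 big1.
rewrite (bigD1 (Ordinal (lti : (i < N)%N))) //= eqxx big1 ?addr0 // => l neq.
rewrite (_ : (i.+1 == l.+1) = false) //; apply: contraNF neq => /eqP[il].
by apply/eqP/val_inj.
Qed.

(** With b_a for [binom_syz mu nu a], row j of the right-hand side is X^2 b_{j+1} - 2 X b_j +
    b_{j-1}. All three terms have exponent weight - j, and [partial_weight_rec] gives the
    coefficient mu_j - nu_j. *)
Lemma binom_gradient : \col_j rnc_eval ('X_[mu] - 'X_[nu])^`M(j) =
  dmx 1 'X n *m (dmx 1 'X m.+1 *m \col_(l < m.+1) binom_syz mu nu l.+1).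
Proof.
rewrite mul_dmx_col ?binom_syz_origin ?binom_syz_large //.
pose h a := 'X * binom_syz mu nu a - binom_syz mu nu a.-1.
rewrite (_ : \col_i _ = \col_(i < n) h i.+1) //.
rewrite mul_dmx_col /h ?binom_syz_origin ?binom_syz_large ?mulr0 ?subr0 //.
apply/matrixP => j j'; rewrite ord1 !mxE rnc_eval_binom_deriv /=.
have -> : binom_syz mu nu j.-1 = ((partial_weight j.-1 mu)%:R - (partial_weight j.-1 nu)%:R)
    *: 'X^(weight mu - j).
  case: (nat_of_ord j) => [|a] //=; rewrite /binom_syz.
  by rewrite !partial_weight0 // subrr !scale0r.
rewrite mulrBr !mulX_binom_syz -scalerAr -exprS.
have -> : ((partial_weight j.+1 mu)%:R - (partial_weight j.+1 nu)%:R)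
    *: 'X^((weight mu - j.+1).+1) = ((partial_weight j.+1 mu)%:R - (partial_weight j.+1 nu)%:R)
    *: 'X^(weight mu - j) :> {poly k}.
  have [wa|wa] := leqP (weight mu) j; last by rewrite -subSn // subSS.
  have : binom_syz mu nu j.+1 = 0.
    apply: binom_syz0 => l /leq_weight; rewrite -?weight_eq => /leq_trans; apply;
    exact: leqW.
  move/eqP; rewrite scaler_eq0 expf_eq0 polyX_eq0 andbF orbF => /eqP ->.
  by rewrite !scale0r.
rewrite -!scalerBl; congr (_ *: _).
have := congr1 (fun x => x%:R : k) (@partial_weight_rec j mu j erefl).
have := congr1 (fun x => x%:R : k) (@partial_weight_rec j nu j erefl).
rewrite -!addnn !natrD => /(canRL (addKr _)) -> /(canRL (addKr _)) ->; ring.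
Qed.

End BinomialGradient.

Section Forms.
Variables n d : nat.
Local Notation N := #|monoms n d|.

Definition mon (i : 'I_N) : 'X_{1..n.+1} := bmnm (enum_val i).

Lemma mdeg_mon i : mdeg (mon i) = d.
Proof. by have := enum_valP i; rewrite inE => /eqP. Qed.

Lemma mon_inj : injective mon.
Proof. by move=> i j /val_inj /enum_val_inj. Qed.

Lemma mon_index mu : mdeg mu = d -> exists i, mon i = mu.
Proof.
move=> md; have lt_md : (mdeg mu < d.+1)%N by rewrite md.
have mu_in : BMultinom lt_md \in monoms n d by rewrite inE /= md.
by exists (enum_rank_in mu_in (BMultinom lt_md)); rewrite /mon enum_rankK_in.
Qed.

Definition form_of (R : nzRingType) (c : 'I_N -> R) : {mpoly R[n.+1]} :=
  \sum_i c i *: 'X_[mon i].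

Lemma dhomog_form_of (R : nzRingType) (c : 'I_N -> R) : form_of c \is d.-homog.
Proof. by apply: rpred_sum => i _; apply: dhomogZ; rewrite dhomogX /= mdeg_mon. Qed.

Lemma mcoeff_form_of (R : nzRingType) (c : 'I_N -> R) i : (form_of c)@_(mon i) = c i.
Proof.
rewrite raddf_sum (bigD1 i) //= mcoeffZ mcoeffX eqxx mulr1 big1 ?addr0 // => j neq.
rewrite mcoeffZ mcoeffX (_ : (mon j == mon i) = false) ?mulr0 //.
by apply: contraNF neq => /eqP/mon_inj/eqP.
Qed.

Lemma dhomog_ext (R : nzRingType) (F G : {mpoly R[n.+1]}) :
  F \is d.-homog -> G \is d.-homog -> (forall i, F@_(mon i) = G@_(mon i)) -> F = G.
Proof.
move=> Fd Gd FG; apply/mpolyP => mu; have [md|md] := eqVneq (mdeg mu) d.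
  by have [i <-] := mon_index md.
by rewrite !(dhomog_nemf_coeff (mf := mdeg) (d := d)).
Qed.

Lemma form_of_coefs (k : fieldType) (F : {mpoly k[n.+1]}) :
  F \is d.-homog -> form_of (coefs n d F) = F.
Proof.
move=> Fd; apply: dhomog_ext => //; first exact: dhomog_form_of.
by move=> i; rewrite mcoeff_form_of.
Qed.

End Forms.

Lemma map_comp_mpoly (R S : comNzRingType) (phi : {rmorphism R -> S}) n1 n2
    (p : {mpoly R[n1]}) (lq : n1.-tuple {mpoly R[n2]}) :
  map_mpoly phi (p \mPo lq) =
  map_mpoly phi p \mPo [tuple map_mpoly phi (tnth lq i) | i < n1].
Proof.
elim/mpoly_ring_ind: p => [c|i|p q IHp IHq|p q IHp IHq].
- by rewrite comp_mpolyC !map_mpolyC comp_mpolyC.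
- by rewrite map_mpolyX !comp_mpolyXU -!tnth_nth tnth_mktuple.
- by rewrite comp_mpolyD !raddfD /= IHp IHq.
by rewrite !rmorphM /= IHp IHq.
Qed.

(** * Forms vanishing on the rational normal curve *)

Section Cone.
Variable m : nat.
Local Notation n := m.+2.
Local Notation N := #|monoms n n|.
Local Notation mon := (@mon n n).

Definition weight_rep (i : 'I_N) : 'I_N :=
  odflt i [pick j | weight (mon j) == weight (mon i)].

Lemma weight_repE i : weight (mon (weight_rep i)) = weight (mon i).
Proof. by rewrite /weight_rep; case: pickP => [j /eqP|]. Qed.

Lemma weight_rep_eq i j : weight (mon i) = weight (mon j) -> weight_rep i = weight_rep j.
Proof.
move=> wij; rewrite /weight_rep; under eq_pick do rewrite wij.
by case: pickP => // /(_ j); rewrite eqxx.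
Qed.

(* By [cone_form_coefs], these are all the forms vanishing on the curve. *)
Definition cone_form (R : nzRingType) (b : 'I_N -> R) : {mpoly R[n.+1]} :=
  \sum_i b i *: ('X_[mon i] - 'X_[mon (weight_rep i)]).

Lemma dhomog_cone_form (R : nzRingType) (b : 'I_N -> R) : cone_form b \is n.-homog.
Proof.
apply: rpred_sum => i _; apply: dhomogZ.
by apply: rpredB; rewrite dhomogX /= mdeg_mon.
Qed.

Section Field.
Variable k : fieldType.

Lemma rnc_eval_is_linear : linear (@rnc_eval k m).
Proof. by move=> c p q; rewrite /rnc_eval mmapD mmapZ mul_polyC. Qed.
HB.instance Definition _ :=
  GRing.isLinear.Build k {mpoly k[n.+1]} {poly k} _ (@rnc_eval k m) rnc_eval_is_linear.

Lemma rnc_eval_cone_form (b : 'I_N -> k) : rnc_eval (cone_form b) = 0.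
Proof.
rewrite linear_sum big1 // => i _.
by rewrite linearZ linearB /= !rnc_evalX weight_repE subrr scaler0.
Qed.

(** What F and the cone form differ by has, at each representative, the sum of the coefficients of F
    of that weight, which is a coefficient of the restriction of F to the curve. *)
Lemma cone_form_coefs (F : {mpoly k[n.+1]}) : F \is n.-homog -> rnc_eval F = 0 ->
  cone_form (coefs n n F) = F.
Proof.
move=> Fn F0; rewrite /cone_form.
under eq_bigr do rewrite scalerBr.
rewrite big_split /= sumrN -/(form_of _) form_of_coefs //.
rewrite (partition_big weight_rep predT) //= big1 ?subr0 // => j _.
have [i0 /eqP i0j|no_i] := pickP (fun i => weight_rep i == j); last first.
  by rewrite big1 // => i; rewrite no_i.
rewrite (eq_bigr (fun i => F@_(mon i) *: 'X_[mon j])) => [|i /eqP <- //].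
rewrite -scaler_suml (_ : \sum_(_ | _) _ = 0) ?scale0r //.
have := congr1 (fun p : {poly k} => p`_(weight (mon i0))) F0.
rewrite coef0 -{1}(form_of_coefs Fn) linear_sum coef_sum => E.
rewrite -[RHS]E [LHS]big_mkcond; apply: eq_bigr => i _.
rewrite linearZ /= rnc_evalX coefZ coefXn /coefs -/(mon i).
case: eqP => [ij|ij]; last case: eqP => [wi|]; rewrite ?mulr0 //.
  by rewrite -weight_repE i0j -ij weight_repE eqxx mulr1.
by case: ij; rewrite -i0j; apply: weight_rep_eq.
Qed.

Definition basis_syz (i : 'I_N) (l : 'I_m.+1) : {poly k} :=
  binom_syz k (mon i) (mon (weight_rep i)) l.+1.

Definition cone_syz (b : 'I_N -> k) (l : 'I_m.+1) : {poly k} :=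
  \sum_i b i *: basis_syz i l.

Lemma size_basis_syz i l : (size (basis_syz i l) <= (m.+3 * m).+1)%N.
Proof. by apply: size_binom_syz; rewrite ?mdeg_mon ?weight_repE. Qed.

Lemma size_cone_syz b l : (size (cone_syz b l) <= (m.+3 * m).+1)%N.
Proof.
apply: (leq_trans (size_sum _ _ _)); apply/bigmax_leqP => i _.
exact: leq_trans (size_scale_leq _ _) (size_basis_syz i l).
Qed.

Definition gradient_syz (G : {mpoly k[n.+1]}) (r : 'I_m.+1 -> {poly k}) :=
  \col_j rnc_eval G^`M(j) = dmx 1 'X n *m (dmx 1 'X m.+1 *m \col_l r l).

Lemma gradient_syz_sum (I : finType) (b : I -> k) (G : I -> {mpoly k[n.+1]}) r :
  (forall i, gradient_syz (G i) (r i)) ->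
  gradient_syz (\sum_i b i *: G i) (fun l => \sum_i b i *: r i l).
Proof.
rewrite /gradient_syz => Gr.
have -> : \col_l (\sum_i b i *: r i l) = \sum_i (b i)%:P *: \col_l r i l.
  apply/matrixP => l j; rewrite !mxE summxE; apply: eq_bigr => i _.
  by rewrite !mxE mul_polyC.
rewrite !mulmx_sumr; apply/matrixP => j j'; rewrite mxE summxE.
rewrite (big_morph _ (mderivD j) (mderiv0 _ j)) linear_sum; apply: eq_bigr => i _.
rewrite -!scalemxAr mxE -Gr mxE mderivZ linearZ /=.
by rewrite mul_polyC.
Qed.

Lemma cone_form_gradient b : gradient_syz (cone_form b) (cone_syz b).
Proof.
apply: gradient_syz_sum => i; apply: binom_gradient; rewrite ?mdeg_mon //.
by rewrite weight_repE.
Qed.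

Lemma dmx_col_inj M : injective (fun c : 'cV[{poly k}]_M => dmx 1 'X M *m c).
Proof.
move=> c c' /= eqc; suff: c - c' = 0 by move/eqP; rewrite subr_eq0 => /eqP.
have : dmx 1 'X M *m (c - c') = 0 by rewrite mulmxBr eqc subrr.
move: (c - c') => {c c' eqc} c c0.
suff H a : forall l : 'I_M, (l < a)%N -> c l ord0 = 0.
  by apply/matrixP => l j; rewrite ord1 mxE (H l.+1).
elim: a => // a IH l; rewrite ltnS leq_eqVlt => /predU1P[la|]; last exact: IH.
have /matrixP/(_ (widen_ord (leqnSn M) l) ord0) := c0; rewrite !mxE (bigD1 l) //=.
rewrite mxE eqxx /= (_ : (l == l.+1 :> nat) = false); last by lia.
rewrite subr0 mulr1n big1 ?addr0.
  by move/eqP; rewrite mulf_eq0 polyX_eq0 => /eqP.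
move=> l' neq; rewrite mxE /=.
rewrite (_ : (l == l' :> nat) = false); last first.
  by apply: contraNF neq => /eqP E; apply/eqP/val_inj.
case: eqP => [E|_]; last by rewrite subrr mul0r.
by rewrite IH ?mulr0 // -la E.
Qed.

(** This identifies the r read off from the defining binomials of the special form with the one of
    its expansion as a cone form. *)
Lemma gradient_syz_unique G r r' : gradient_syz G r -> gradient_syz G r' -> r =1 r'.
Proof.
rewrite /gradient_syz => -> /dmx_col_inj/dmx_col_inj/matrixP E l.
by have := E l ord0; rewrite !mxE.
Qed.

End Field.
End Cone.

(** * A form with explicit syzygies *)

Section SpecialForm.
Variables (k : fieldType) (m : nat).
Local Notation n := m.+2.
Local Notation N := #|monoms n n|.

Lemma mnm_dotD M (f : 'I_M -> nat) (mu nu : 'X_{1..M}) :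
  (\sum_i (mu + nu)%MM i * f i = \sum_i mu i * f i + \sum_i nu i * f i)%N.
Proof. by rewrite -big_split; apply: eq_bigr => i _; rewrite mnmDE mulnDl. Qed.

Lemma mnm_dotU M (f : 'I_M -> nat) j e : (\sum_i (U_(j) *+ e)%MM i * f i = e * f j)%N.
Proof.
rewrite (bigD1 j) //= mulmnE mnm1E eqxx mul1n big1 ?addn0 // => i ij.
by rewrite mulmnE mnm1E eq_sym (negbTE ij).
Qed.

(** This factor has weight n l; with the shift by l of the quadric x_l x_{l+2} - x_{l+1}^2 it spaces
    the r_l exactly n + 1 apart, so that multiples of them by forms of degree n do not overlap. *)
Let base (l : 'I_m.+1) : 'X_{1..n.+1} := (U_(ord0) *+ (m - l) + U_(ord_max) *+ l)%MM.
Let mu (l : 'I_m.+1) : 'X_{1..n.+1} :=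
  (base l + (U_(inord l) *+ 1 + U_(inord l.+2) *+ 1))%MM.
Let nu (l : 'I_m.+1) : 'X_{1..n.+1} := (base l + U_(inord l.+1) *+ 2)%MM.

Let dot_mu (f : nat -> nat) l : (\sum_(i < n.+1) mu l i * f i =
  (m - l) * f 0 + l * f n + (f l + f l.+2))%N.
Proof.
have ltl := ltn_ord l.
rewrite !(mnm_dotD (fun i => f (nat_of_ord i))).
rewrite !(mnm_dotU (fun i => f (nat_of_ord i))) !mul1n /=.
rewrite !inordK; lia.
Qed.

Let dot_nu (f : nat -> nat) l : (\sum_(i < n.+1) nu l i * f i =
  (m - l) * f 0 + l * f n + 2 * f l.+1)%N.
Proof.
have ltl := ltn_ord l.
rewrite (mnm_dotD (fun i => f (nat_of_ord i)) (base l)) mnm_dotD.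
rewrite !(mnm_dotU (fun i => f (nat_of_ord i))).
rewrite /= inordK; lia.
Qed.

Let mdeg_mu l : mdeg (mu l) = n.
Proof.
rewrite mdegE (eq_bigr (fun i => mu l i * 1)%N) => [|i _]; last by rewrite muln1.
by rewrite (dot_mu (fun=> 1%N)); have := ltn_ord l; lia.
Qed.

Let mdeg_nu l : mdeg (nu l) = n.
Proof.
rewrite mdegE (eq_bigr (fun i => nu l i * 1)%N) => [|i _]; last by rewrite muln1.
by rewrite (dot_nu (fun=> 1%N)); have := ltn_ord l; lia.
Qed.

Let weight_mu l : weight (mu l) = (l * n + l.*2.+2)%N.
Proof. by rewrite /weight (dot_mu id); lia. Qed.

Let weight_nu l : weight (nu l) = weight (mu l).
Proof. by rewrite weight_mu /weight (dot_nu id); lia. Qed.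

(** The contribution of [base] cancels, and the quadric leaves the second difference of [subn j.+1]
    centred at l + 1, which is 1 for j = l and 0 otherwise. *)
Let syz_mu_nu l (j : 'I_m.+1) :
  binom_syz k (mu l) (nu l) j.+1 = (j == l)%:R *: 'X^(m.+3 * l).
Proof.
rewrite /binom_syz weight_mu /partial_weight (dot_mu (subn j.+1)) (dot_nu (subn j.+1)).
have -> : (j.+1 - l + (j.+1 - l.+2) = (j == l) + 2 * (j.+1 - l.+1))%N.
  have [->|jl] := eqVneq j l; first by rewrite subnn subSnn; lia.
  have {}jl : nat_of_ord j <> l by move/val_inj => E; rewrite E eqxx in jl.
  by lia.
rewrite addnCA natrD addrK; have [->|] := eqVneq j l; last by rewrite !scale0r.
by congr (_ *: _); congr ('X^_); lia.
Qed.

(* sum_l x_0^(m - l) x_n^l (x_l x_{l+2} - x_{l+1}^2), for which r_l = t^((n + 1) l). *)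
Definition special_form : {mpoly k[n.+1]} :=
  \sum_(l < m.+1) 1 *: ('X_[mu l] - 'X_[nu l]).

Lemma dhomog_special_form : special_form \is n.-homog.
Proof.
apply: rpred_sum => l _; apply: dhomogZ.
by apply: rpredB; rewrite dhomogX; apply/eqP; [apply: mdeg_mu|apply: mdeg_nu].
Qed.

Lemma rnc_eval_special_form : rnc_eval special_form = 0.
Proof.
rewrite linear_sum big1 // => l _.
by rewrite linearZ linearB /= !rnc_evalX weight_nu subrr scaler0.
Qed.

Lemma special_form_gradient :
  gradient_syz special_form (fun l : 'I_m.+1 => 'X^(m.+3 * l)).
Proof.
have := @gradient_syz_sum m k _ (fun=> 1) (fun l => 'X_[mu l] - 'X_[nu l])
  (fun l (j : 'I_m.+1) => binom_syz k (mu l) (nu l) j.+1).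
rewrite /gradient_syz.
have <- : \col_(j < m.+1) \sum_(l < m.+1) 1 *: binom_syz k (mu l) (nu l) j.+1 =
    \col_(j < m.+1) 'X^(m.+3 * j).
  apply/matrixP => j j'; rewrite !mxE (bigD1 j) //= syz_mu_nu eqxx !scale1r.
  rewrite big1 ?addr0 // => l lj.
  by rewrite syz_mu_nu eq_sym (negbTE lj) scale0r scaler0.
by apply => l; apply: binom_gradient; [apply: mdeg_mu|apply: mdeg_nu|rewrite weight_nu].
Qed.

Definition special_coefs := coefs n n special_form.

Lemma cone_form_special : cone_form special_coefs = special_form.
Proof. exact: cone_form_coefs dhomog_special_form rnc_eval_special_form. Qed.

Lemma cone_syz_special l : cone_syz special_coefs l = 'X^(m.+3 * l).
Proof.
move: l; apply: (@gradient_syz_unique m k special_form); last exact: special_form_gradient.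
by rewrite -cone_form_special; apply: cone_form_gradient.
Qed.

Lemma syz_nondeg_special : syz_nondeg (cone_syz special_coefs).
Proof.
move=> z sz zr; apply: (chunks_unique (K := m.+3)) => //.
by rewrite -[RHS]zr; apply: eq_bigr => l _; rewrite cone_syz_special.
Qed.

Lemma dot_special_gradient (g : 'rV[{poly k}]_n.+1) :
  \sum_j g ord0 j * rnc_eval special_form^`M(j) =
  \sum_l (g *m dmx 1 'X n *m dmx 1 'X m.+1) ord0 l * 'X^(m.+3 * l).
Proof.
have := congr1 (fun c => (g *m c) ord0 ord0) special_form_gradient.
rewrite mxE (eq_bigr (fun j => g ord0 j * rnc_eval special_form^`M(j))); last first.
  by move=> j _; rewrite mxE.
by move=> ->; rewrite !mulmxA mxE; apply: eq_bigr => l _; rewrite [X in _ * X]mxE.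
Qed.

Lemma special_gradient_surj (P : {poly k}) : (size P <= (n * n).+1)%N ->
  exists2 g : 'rV[{poly k}]_n.+1, (forall j, (size (g ord0 j) <= n.+1)%N) &
    \sum_j g ord0 j * rnc_eval special_form^`M(j) = P.
Proof.
(* The blocks have degree at most n + 2, since each of the two lifts through [dmx] lowers the degree
   by one and g must have degree n. *)
move=> sP; have [||z [sz zP]] := @chunks_exist k m.+3 m.+3.+2 m P; first by lia.
  by apply: leq_trans sP _; lia.
have [||w wE sw] := @poly_dmx_lift k m.+1 m.+3 (\row_l z l).
- by rewrite ltnS leqW // leqW.
- by move=> l; rewrite mxE.
have [||g gE sg] := @poly_dmx_lift k m.+2 m.+2 w; rewrite ?leqnSn //.
exists g => //; rewrite dot_special_gradient gE wE -[RHS]zP.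
by apply: eq_bigr => l _; rewrite mxE.
Qed.

End SpecialForm.

Lemma coef1_mmap_line (k : fieldType) n (p : {mpoly k[n]}) (x y : 'I_n -> k) :
  (mmap polyC (fun u => (x u)%:P + 'X * (y u)%:P) p)`_1 =
  \sum_u y u * (p^`M(u)).@[x].
Proof.
have [rho ->] := mmap_taylor polyC p (fun u => (x u)%:P) (fun u => (y u)%:P) 'X.
rewrite mmap_polyC_const expr2 -mulrA -addrA -mulrDr coefD coefC add0r coefXM /=.
rewrite coefD coefXM addr0.
rewrite coef_sum; apply: eq_bigr => u _.
by rewrite mmap_polyC_const -polyCM coefC.
Qed.

(** * The map (A, b) |-> (cone form of b) o A and its differential *)

Section Parametrization.
Variable m : nat.
Local Notation n := m.+2.
Local Notation N := #|monoms n n|.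
Local Notation M := (n.+1 * n.+1 + N)%N.
Local Notation mon := (@mon n n).

Lemma map_cone_form (R S : comNzRingType) (phi : {rmorphism R -> S}) (b : 'I_N -> R) :
  map_mpoly phi (cone_form b) = cone_form (phi \o b).
Proof.
rewrite /cone_form raddf_sum; apply: eq_bigr => i _ /=.
by rewrite map_mpolyZ raddfB /= !map_mpolyX.
Qed.

Lemma map_linear_comp (R S : comNzRingType) (phi : {rmorphism R -> S}) a
    (A : 'M[R]_a) (p : {mpoly R[a]}) :
  map_mpoly phi (linear_comp A p) = linear_comp (map_mx phi A) (map_mpoly phi p).
Proof.
rewrite /linear_comp map_comp_mpoly; congr comp_mpoly.
apply: eq_from_tnth => j; rewrite !tnth_mktuple raddf_sum; apply: eq_bigr => i _ /=.
by rewrite map_mpolyZ map_mpolyX mxE.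
Qed.

Lemma map_mpoly_deriv (R S : comNzRingType) (phi : {rmorphism R -> S}) a j
    (p : {mpoly R[a]}) : map_mpoly phi p^`M(j) = (map_mpoly phi p)^`M(j).
Proof.
by apply/mpolyP => mu; rewrite !(mcoeff_map_mpoly, mcoeff_mderiv) raddfMn.
Qed.

Section Point.
Variable R : comNzRingType.
Implicit Types x : 'I_M -> R.

Definition param_mx x : 'M[R]_n.+1 := \matrix_(i, j) x (lshift N (mxvec_index i j)).
Definition param_cone x (i : 'I_N) : R := x (rshift (n.+1 * n.+1) i).
Definition param_form x := linear_comp (param_mx x) (cone_form (param_cone x)).

Definition param_point (A : 'M[R]_n.+1) (b : 'I_N -> R) (u : 'I_M) : R :=
  match fintype.split u with inl v => mxvec A ord0 v | inr i => b i end.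

Lemma param_mx_point A b : param_mx (param_point A b) = A.
Proof.
apply/matrixP => i j; rewrite mxE /param_point.
by rewrite (unsplitK (inl (mxvec_index i j))) mxvecE.
Qed.

Lemma param_cone_point A b : param_cone (param_point A b) =1 b.
Proof. by move=> i; rewrite /param_cone /param_point (unsplitK (inr i)). Qed.

End Point.

Lemma eq_cone_form (R : nzRingType) (b b' : 'I_N -> R) : b =1 b' -> cone_form b = cone_form b'.
Proof. by move=> bb; apply: eq_bigr => i _; rewrite bb. Qed.

Lemma map_param_form (R S : comNzRingType) (phi : {rmorphism R -> S}) (x : 'I_M -> R) :
  map_mpoly phi (param_form x) = param_form (phi \o x).
Proof.
rewrite /param_form map_linear_comp map_cone_form.
by congr linear_comp; apply/matrixP => i j; rewrite !mxE.
Qed.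

Variable k : fieldType.

(** A coefficient of the form at the universal point, whose coordinates are indeterminates; it
    specializes to points over any commutative k-algebra, in particular over k[X]. *)
Definition param_coef (i : 'I_N) : {mpoly k[M]} :=
  (param_form (fun u => 'X_u : {mpoly k[M]}))@_(mon i).

Lemma mmap_param_coef (S : comNzRingType) (phi : {rmorphism k -> S}) x i :
  mmap phi x (param_coef i) = (param_form x)@_(mon i).
Proof.
rewrite -mcoeff_map_mpoly map_param_form; congr (mcoeff _ (linear_comp _ _)).
  by apply/matrixP => a b; rewrite !mxE /= mmapX mmap1U.
by apply: eq_cone_form => a; rewrite /param_cone /= mmapX mmap1U.
Qed.

Lemma meval_param_coef (x : 'I_M -> k) i : (param_coef i).@[x] = (param_form x)@_(mon i).
Proof. exact: mmap_param_coef. Qed.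

Lemma cone_form_line (b0 b : 'I_N -> k) :
  cone_form (fun i => (b0 i)%:P + 'X * (b i)%:P) =
  map_mpoly polyC (cone_form b0) + 'X *: map_mpoly polyC (cone_form b).
Proof.
rewrite !map_cone_form /cone_form scaler_sumr -big_split; apply: eq_bigr => i _ /=.
by rewrite scalerDl scalerA.
Qed.

Lemma linear_comp_line (R : comNzRingType) a (h : R) (Y : 'M[R]_a) (p : {mpoly R[a]}) :
  exists rho, linear_comp (1%:M + h *: Y) p =
    p + h *: (\sum_j (\sum_i Y i j *: 'X_i) * p^`M(j)) + h ^+ 2 *: rho.
Proof.
have [rho E] := mmap_taylor (@mpolyC a R) p (fun i => 'X_i)
  (fun j => \sum_i Y i j *: 'X_i) h%:MP.
have mmapid q : mmap (@mpolyC a R) (fun i => 'X_i) q = q.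
  rewrite -[RHS]comp_mpoly_id; apply: eq_bigr => mu _; congr (_ * _).
  by apply: mmap1_eq => i; rewrite tnth_mktuple.
exists rho; transitivity (mmap (@mpolyC a R)
    (fun j => 'X_j + h%:MP * \sum_i Y i j *: 'X_i) p).
  apply: eq_bigr => mu _; congr (_ * _); apply: mmap1_eq => j; rewrite tnth_mktuple.
  under eq_bigr do rewrite !mxE scalerDl -scalerA.
  rewrite big_split /= -scaler_sumr mul_mpolyC; congr (_ + _).
  rewrite (bigD1 j) //= eqxx scale1r big1 ?addr0 // => i ij.
  by rewrite (negbTE ij) scale0r.
rewrite E mmapid -!mul_mpolyC rmorphXn /=; congr (_ + _ * _ + _).
by apply: eq_bigr => j _; rewrite mmapid.
Qed.

(** The derivative in the direction (Y, b) is read off as the coefficient of X of the form at the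
    point (1 + X Y, b0 + X b) over k[X]. *)
Lemma param_form_jacobian (b0 b : 'I_N -> k) (Y : 'M[k]_n.+1) i :
  \sum_u param_point Y b u * ((param_coef i)^`M(u)).@[param_point 1%:M b0] =
  (cone_form b + \sum_j (\sum_i Y i j *: 'X_i) * (cone_form b0)^`M(j))@_(mon i).
Proof.
rewrite -coef1_mmap_line mmap_param_coef.
set x := fun u => _.
pose YP := map_mx (@polyC k) Y; pose p := cone_form (fun i => (b0 i)%:P + 'X * (b i)%:P).
have coneE : cone_form (param_cone x) = p.
  apply: eq_cone_form => a.
  by rewrite -(param_cone_point (1%:M : 'M[k]_n.+1) b0) -(param_cone_point Y b).
have param_mxE : param_mx x = 1%:M + 'X *: YP.
  have := param_mx_point 1%:M b0; have := param_mx_point Y b.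
  move=> /matrixP EY /matrixP E1; apply/matrixP => a c.
  by rewrite !mxE -EY !mxE /x; have := E1 a c; rewrite !mxE => ->; rewrite rmorph_nat.
rewrite /param_form coneE param_mxE.
have [rho ->] := linear_comp_line 'X YP p.
have ev0 (q : {mpoly {poly k}[n.+1]}) mu :
    (q@_mu)`_0 = (map_mpoly (horner_eval (0 : k)) q)@_mu.
  by rewrite mcoeff_map_mpoly /= horner_evalE horner_coef0.
have evC (q : {mpoly k[n.+1]}) : map_mpoly (horner_eval (0 : k)) (map_mpoly polyC q) = q.
  by apply/mpolyP => mu; rewrite !mcoeff_map_mpoly /= ?horner_evalE hornerC.
have pE : p = map_mpoly polyC (cone_form b0) + 'X *: map_mpoly polyC (cone_form b).
  exact: cone_form_line.
have evp : map_mpoly (horner_eval (0 : k)) p = cone_form b0.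
  rewrite pE rmorphD /= map_mpolyZ !evC /= horner_evalE hornerX scale0r addr0 //.
rewrite !mcoeffD !mcoeffZ expr2 -mulrA !coefD !coefXM /= addr0.
rewrite {1}pE mcoeffD mcoeffZ coefD coefXM !mcoeff_map_mpoly /= coefC add0r coefC /=.
congr (_ + _); rewrite ev0; congr (mcoeff _ _); rewrite raddf_sum /=.
apply: eq_bigr => j _; rewrite rmorphM /= map_mpoly_deriv evp; congr (_ * _).
rewrite raddf_sum; apply: eq_bigr => a _ /=.
by rewrite map_mpolyZ map_mpolyX mxE /= ?horner_evalE hornerC.
Qed.

End Parametrization.

Section Dominance.
Variables (k : closedFieldType) (m : nat).
Local Notation n := m.+2.
Local Notation N := #|monoms n n|.
Local Notation M := (n.+1 * n.+1 + N)%N.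
Local Notation mon := (@mon n n).
Local Notation x0 := (param_point 1%:M (@special_coefs k m)).

Lemma size_rnc_eval d (p : {mpoly k[n.+1]}) : p \is d.-homog ->
  (size (rnc_eval p) <= (d * n).+1)%N.
Proof.
move=> pd; rewrite -dehom_comp_rnc; apply: size_dehom.
by apply: dhomog_comp_mpoly => // i; rewrite tnth_mktuple dhomog_bform.
Qed.

(** The matrix direction Y is chosen to reproduce the restriction of the target to the curve; the
    rest vanishes on the curve and is supplied by the cone direction. *)
Lemma param_jacobian_surj (w : 'I_N -> k) : exists y : 'I_M -> k,
  forall i, \sum_u y u * ((param_coef k i)^`M(u)).@[x0] = w i.
Proof.
have Wn : form_of w \is n.-homog := dhomog_form_of w.
have [g sg gP] := special_gradient_surj (size_rnc_eval Wn).
(* Each g_j has degree at most n, so it is the restriction to the curve of a linear form, whose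
   coefficients form column j. *)
pose Y : 'M[k]_n.+1 := \matrix_(i, j) (g ord0 j)`_i.
pose V := \sum_j (\sum_i Y i j *: 'X_i) * (special_form k m)^`M(j).
have Vn : V \is n.-homog.
  apply: rpred_sum => j _; rewrite -[n]/(1 + m.+1)%N; apply: dhomogM.
    by apply: rpred_sum => i _; apply: dhomogZ; rewrite dhomogX /= mdeg1.
  exact/dhomog_mderiv/dhomog_special_form.
have VP : rnc_eval V = rnc_eval (form_of w).
  have rnc_evalM p q : rnc_eval (p * q) = rnc_eval p * rnc_eval q :> {poly k}.
    exact: rmorphM.
  rewrite -gP linear_sum; apply: eq_bigr => j _ /=.
  rewrite rnc_evalM; congr (_ * _); rewrite linear_sum.
  rewrite -[RHS](take_poly_id (sg j)) /take_poly poly_def; apply: eq_bigr => i _.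
  by rewrite linearZ mxE /= /rnc_eval mmapX mmap1U.
have diffP : rnc_eval (form_of w - V) = 0 by rewrite linearB /= VP subrr.
have diffn : form_of w - V \is n.-homog by apply: rpredB.
exists (param_point Y (coefs n n (form_of w - V))) => i.
rewrite param_form_jacobian cone_form_special (cone_form_coefs diffn diffP) -/V.
by rewrite subrK mcoeff_form_of.
Qed.

Let syzN (r : 'I_m.+1 -> {poly k}) := syz_mx m.+3 (m.+1 * m.+3) r.

Lemma syz_mx_cone_syz (b : 'I_N -> k) :
  syzN (cone_syz b) = \sum_i b i *: syzN (@basis_syz m k i).
Proof.
apply/row_matrixP => a; rewrite !rowE mulmx_sumr mul_syz_mx.
set v := delta_mx _ _; pose z l := rVpoly (row l (vec_mx v : 'M_(m.+1, m.+3))).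
transitivity (poly_rV (\sum_i b i *: \sum_l z l * basis_syz k i l) :
    'rV[k]_(m.+1 * m.+3)).
  congr poly_rV; under [RHS]eq_bigr do rewrite scaler_sumr.
  rewrite exchange_big; apply: eq_bigr => l _; rewrite mulr_sumr.
  by apply: eq_bigr => i _; rewrite scalerAr.
rewrite linear_sum; apply: eq_bigr => i _.
by rewrite linearZ -scalemxAr mul_syz_mx.
Qed.

Definition param_disc : {mpoly k[M]} :=
  \det (param_mx (fun u => 'X_u : {mpoly k[M]})) *
  \det (\sum_i param_cone (fun u => 'X_u : {mpoly k[M]}) i *:
          map_mx (@mpolyC M k) (syzN (@basis_syz m k i))).

Lemma meval_param_disc (x : 'I_M -> k) : param_disc.@[x] =
  \det (param_mx x) * \det (syzN (cone_syz (param_cone x))).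
Proof.
rewrite mevalM -!det_map_mx; congr (_ * _); congr (\det _).
  by apply/matrixP => i j; rewrite !mxE /= mevalXU.
rewrite raddf_sum syz_mx_cone_syz; apply: eq_bigr => i _ /=.
rewrite map_mxZ /= mevalXU -map_mx_comp; congr (_ *: _).
by apply/matrixP => a b; rewrite mxE /= mevalC.
Qed.

Theorem generic_form_through_rnc : exists2 P : {mpoly k[N]}, P != 0 &
  forall c, P.@[c] != 0 -> exists A (b : 'I_N -> k),
    [/\ A \in unitmx, syz_nondeg (cone_syz b) & form_of c = linear_comp A (cone_form b)].
Proof.
have disc0 : param_disc != 0.
  suff: param_disc.@[x0] != 0 by apply: contraNneq => ->; rewrite meval0.
  rewrite meval_param_disc param_mx_point det1 mul1r.
  rewrite (_ : syzN _ = syzN (cone_syz (@special_coefs k m))).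
    by apply: nondeg_det_syz_mx; [apply: size_cone_syz|apply: syz_nondeg_special].
  by rewrite !syz_mx_cone_syz; apply: eq_bigr => i _; rewrite param_cone_point.
have [P P0 PP] := submersion_image param_jacobian_surj disc0.
exists P => // c /PP[x xc]; rewrite meval_param_disc mulf_eq0 negb_or => /andP[dA db].
exists (param_mx x), (param_cone x); split.
- by rewrite unitmxE unitfE.
- exact: det_syz_mx_nondeg.
apply: dhomog_ext (dhomog_form_of _) (dhomog_linear_comp _ (dhomog_cone_form _)) _ => i.
by rewrite mcoeff_form_of -xc meval_param_coef.
Qed.

End Dominance.

(** * Smoothness of the general hypersurface *)

Section JacobianIdeal.
Variables (k : fieldType) (n d : nat).
Local Notation mpol := {mpoly k[n.+1]}.
Implicit Types (F G g h : mpol).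

(* The multipliers are constrained through all forms, and not only through [F],
   so that the same combination stays homogeneous when [F] is deformed. *)
Definition jac_degree (D : nat) (u : mpol) (v : 'I_n.+1 -> mpol) :=
  (forall G, G \is d.+1.-homog -> u * G \is D.-homog) /\
  (forall j G, G \is d.-homog -> v j * G \is D.-homog).

Definition jac_comb F u (v : 'I_n.+1 -> mpol) := u * F + \sum_j v j * F^`M(j).

Definition jac_mem F D g := exists u v, jac_degree D u v /\ g = jac_comb F u v.

Variable F : mpol.

Lemma jac_memD D g h : jac_mem F D g -> jac_mem F D h -> jac_mem F D (g + h).
Proof.
move=> [u [v [[uD vD] ->]]] [u' [v' [[uD' vD'] ->]]].
exists (u + u'), (fun j => v j + v' j); split.
  split=> [G Gd|j G Gd]; rewrite mulrDl; apply: rpredD.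
  - exact: uD.
  - exact: uD'.
  - exact: vD.
  - exact: vD'.
rewrite /jac_comb mulrDl addrACA -big_split; congr (_ + _).
by apply: eq_bigr => j _; rewrite mulrDl.
Qed.

Lemma jac_memM D e g h : h \is e.-homog -> jac_mem F D g -> jac_mem F (e + D) (h * g).
Proof.
move=> he [u [v [[uD vD] ->]]]; exists (h * u), (fun j => h * v j); split.
  split=> [G Gd|j G Gd]; rewrite -mulrA; apply: dhomogM => //; [exact: uD|exact: vD].
rewrite /jac_comb mulrDr mulrA mulr_sumr; congr (_ + _).
by apply: eq_bigr => j _; rewrite mulrA.
Qed.

Lemma jac_mem0 D : jac_mem F D 0.
Proof.
exists 0, (fun=> 0); split.
  by split=> [G _|j G _]; rewrite mul0r dhomog0.
by rewrite /jac_comb mul0r add0r big1 // => j _; rewrite mul0r.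
Qed.

Lemma jac_mem_sum D (I : Type) (r : seq I) (P : pred I) (f : I -> mpol) :
  (forall i, P i -> jac_mem F D (f i)) -> jac_mem F D (\sum_(i <- r | P i) f i).
Proof.
by move=> fD; elim/big_ind: _ => //; [apply: jac_mem0|move=> g h; apply: jac_memD].
Qed.

Lemma jac_mem_self : jac_mem F d.+1 F.
Proof.
exists 1, (fun=> 0); split.
  by split=> [G Gd|j G _]; rewrite ?mul1r // mul0r dhomog0.
by rewrite /jac_comb mul1r big1 ?addr0 // => j _; rewrite mul0r.
Qed.

Lemma jac_mem_deriv j : jac_mem F d F^`M(j).
Proof.
exists 0, (fun i => (i == j)%:R); split.
  split=> [G _|i G Gd]; first by rewrite mul0r dhomog0.
  by case: eqP => _; rewrite ?mul1r ?mul0r ?dhomog0.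
rewrite /jac_comb mul0r add0r (bigD1 j) //= eqxx mul1r big1 ?addr0 // => i ij.
by rewrite (negbTE ij) mul0r.
Qed.

(** The radical of the ideal of F and its derivatives, with degrees recorded. *)
Definition jac_nil q g := g \is q.-homog /\ exists e, jac_mem F (q * e) (g ^+ e).

Lemma jac_nil_mem q g : g \is q.-homog -> jac_mem F q g -> jac_nil q g.
Proof. by move=> gq gF; split=> //; exists 1%N; rewrite muln1 expr1. Qed.

Lemma jac_nilM q e g h : h \is e.-homog -> jac_nil q g -> jac_nil (e + q) (h * g).
Proof.
move=> he [gq [a ga]]; split; first exact: dhomogM.
by exists a; rewrite exprMn mulnDl; apply: jac_memM => //; apply: dhomogMn.
Qed.

(** Every term of the expansion of (g + h)^(a+b) contains g^a or h^b. *)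
Lemma jac_nilD q g h : jac_nil q g -> jac_nil q h -> jac_nil q (g + h).
Proof.
move=> [gq [a ga]] [hq [b hb]]; split; first exact: rpredD.
exists (a + b)%N; rewrite exprDn; apply: jac_mem_sum => i _.
have ltS := ltn_ord i; rewrite -mulr_natl.
rewrite -[(q * (a + b))%N]add0n; apply: jac_memM.
  by rewrite -mpolyC_nat; apply: dhomogC.
have [ai|ib] := leqP b i.
  rewrite (_ : h ^+ i = h ^+ (i - b) * h ^+ b) ?mulrA; last by rewrite -exprD subnK.
  have -> : (q * (a + b) = q * (a + b - i + (i - b)) + q * b)%N.
    by rewrite -mulnDr; congr (_ * _)%N; lia.
  apply: jac_memM => //; rewrite mulnDr.
  by apply: dhomogM; apply: dhomogMn.
have -> : (a + b - i = b - i + a)%N by lia.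
rewrite exprD mulrAC.
have -> : (q * (a + b) = q * (b - i + i) + q * a)%N.
  by rewrite -mulnDr; congr (_ * _)%N; lia.
apply: jac_memM => //; rewrite mulnDr.
by apply: dhomogM; apply: dhomogMn.
Qed.

Lemma jac_nilZ q c g : jac_nil q g -> jac_nil q (c *: g).
Proof.
by move=> gN; rewrite -mul_mpolyC -[q]add0n; apply: jac_nilM => //; apply: dhomogC.
Qed.

Lemma jac_nil_sum q (I : Type) (r : seq I) (P : pred I) (f : I -> mpol) :
  (forall i, P i -> jac_nil q (f i)) -> jac_nil q (\sum_(i <- r | P i) f i).
Proof.
move=> fD; elim/big_ind: _ => //; last by move=> g h; apply: jac_nilD.
by split; [apply: dhomog0|exists 1%N; rewrite expr1; apply: jac_mem0].
Qed.

Lemma jac_nil_root i e : jac_nil e ('X_i ^+ e) -> jac_nil 1 'X_i.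
Proof.
move=> [_ [a ga]]; split; first by rewrite dhomogX /= mdeg1.
by exists (e * a)%N; rewrite mul1n exprM.
Qed.

Lemma jac_mem_monomials : (forall i, jac_nil 1 'X_i) ->
  exists D, (0 < D)%N /\ forall mu, mdeg mu = D -> jac_mem F D 'X_[mu].
Proof.
move=> nilX; have /fin_all_exists[e eP] i : exists e, jac_mem F e ('X_i ^+ e).
  by have [_ [a]] := nilX i; rewrite mul1n; exists a.
(* Pigeonhole: in a monomial of larger degree than the sum of the e_i, some exponent reaches e_i. *)
exists (\sum_i e i).+1; split=> // mu mdeg_mu.
have [i ei] : exists i, (e i <= mu i)%N.
  apply/existsP; apply: contra_eqT mdeg_mu => /existsPn lt_e.
  rewrite mdegE neq_ltn ltnS leq_sum // => i _.
  by have := lt_e i; rewrite -ltnNge => /ltnW.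
have Ei : (U_(i) *+ e i <= mu)%MM.
  apply/mnm_lepP => j; rewrite mulmnE mnm1E.
  by case: eqP => [<-|_]; rewrite ?mul1n ?mul0n.
rewrite -(submK Ei) mpolyXD -mdeg_mu -{1}(submK Ei) mdegD mdegMn mdeg1 mul1n -mpolyXn.
by apply: jac_memM => //; rewrite dhomogX.
Qed.

End JacobianIdeal.

Section SmoothExample.
Variables (k : fieldType).

Lemma mderiv_exp n (g : {mpoly k[n]}) e j :
  (g ^+ e.+1)^`M(j) = e.+1%:R * g ^+ e * g^`M(j).
Proof.
elim: e => [|e IH]; first by rewrite !expr1 expr0 !mul1r.
rewrite exprS mderivM IH -[e.+2]add1n natrD; move: (e.+1%:R) => c.
by rewrite exprS; ring.
Qed.

Variable m : nat.
Local Notation n := m.+2.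
Local Notation x a := ('X_(inord a) : {mpoly k[n.+1]}).

Lemma eq_inord p a b : (a < p.+1)%N -> (b < p.+1)%N ->
  (inord a == inord b :> 'I_p.+1) = (a == b).
Proof. by move=> ap bp; rewrite -val_eqE /= !inordK. Qed.

Lemma dhomogXn_var p (i : 'I_p) e : ('X_i ^+ e : {mpoly k[p]}) \is e.-homog.
Proof.
have := @dhomogMn _ _ _ 1 ('X_i : {mpoly k[p]}) e; rewrite mul1n; apply.
by rewrite dhomogX /= mdeg1.
Qed.

Lemma jac_nil_fermat : n%:R != 0 :> k ->
  exists F : {mpoly k[n.+1]}, F \is n.-homog /\ forall i, jac_nil m.+1 F 1 'X_i.
Proof.
move=> n0; pose F : {mpoly k[n.+1]} := \sum_i 'X_i ^+ n; exists F.
have Fn : F \is n.-homog by apply: rpred_sum => i _; apply: dhomogXn_var.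
split=> // i; apply: (@jac_nil_root _ _ _ _ _ m.+1).
have -> : 'X_i ^+ m.+1 = n%:R^-1 *: F^`M(i).
  rewrite /F (big_morph _ (mderivD i) (mderiv0 _ i)) (bigD1 i) //= big1.
    rewrite addr0 mderiv_exp mderivXU eqxx mulr1 -mpolyC_nat mul_mpolyC scalerA.
    by rewrite mulVf // scale1r.
  by move=> j ji; rewrite mderiv_exp mderivXU (negbTE ji) mulr0.
apply/jac_nilZ/jac_nil_mem; last exact: jac_mem_deriv.
exact: dhomog_mderiv.
Qed.

(* The Fermat form is singular when the characteristic divides n; the partial
   derivatives of x_0^n + sum_a x_a x_{a+1}^(n-1) then kill x_1, ..., x_n in turn. *)
Lemma jac_nil_chain : n%:R = 0 :> k -> (0 < m)%N ->
  exists F : {mpoly k[n.+1]}, F \is n.-homog /\ forall i, jac_nil m.+1 F 1 'X_i.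
Proof.
move=> n0 m0; pose F : {mpoly k[n.+1]} := x 0 ^+ n + \sum_(a < n) x a * x a.+1 ^+ m.+1.
exists F; have Fn : F \is n.-homog.
  apply: rpredD; first exact: dhomogXn_var.
  apply: rpred_sum => a _; rewrite -[n]/(1 + m.+1)%N.
  by apply: dhomogM; [apply: (dhomogXn_var _ 1)|apply: dhomogXn_var].
split=> //.
have derF j : (j < n)%N -> x j.+1 ^+ m.+1 = F^`M(inord j)
    - \sum_(a < n | a.+1 == j) x a * (m.+1%:R * x a.+1 ^+ m).
  move=> ltj; rewrite /F mderivD mderiv_exp -mpolyC_nat n0 mpolyC0 !mul0r add0r.
  rewrite (big_morph _ (mderivD _) (mderiv0 _ _)).
  under [in RHS]eq_bigr do rewrite mderivM mderiv_exp !mderivXU.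
  rewrite big_split /= [X in _ = X + _ - _](bigD1 (Ordinal ltj)) //= eqxx mul1r big1.
    rewrite addr0 [X in _ + X - _](bigID (fun a : 'I_n => a.+1 == j)) /=.
    rewrite [X in _ + (_ + X) - _]big1 ?addr0.
      rewrite (eq_bigr (fun a : 'I_n => x a * (m.+1%:R * x a.+1 ^+ m))) ?addrK //.
      by move=> a /eqP <-; rewrite eqxx mulr1.
    move=> a neq; have -> : (inord a.+1 == inord j :> 'I_n.+1) = false.
      rewrite eq_inord; [exact: negbTE|by rewrite ltnS|exact: ltnW].
    by rewrite !mulr0.
  move=> a; rewrite -val_eqE /= => neq.
  have -> : (inord a == inord j :> 'I_n.+1) = false.
    by rewrite eq_inord; [exact: negbTE|rewrite ltnW // ltnS|exact: ltnW].
  by rewrite mul0r.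
(* Here m > 0 provides the factor x_a in x_a^m; conics are treated separately. *)
have nil_term q (a : nat) (c : {mpoly k[n.+1]}) : c \is q.-homog ->
    jac_nil m.+1 F 1 (x a) -> jac_nil m.+1 F (q + m) (c * x a ^+ m).
  move=> cq nila; rewrite (_ : x a ^+ m = x a ^+ m.-1 * x a) ?mulrA; last first.
    by rewrite -exprSr prednK.
  rewrite (_ : (q + m = q + m.-1 + 1)%N); last by rewrite -addnA addn1 prednK.
  apply: jac_nilM => //.
  by apply: dhomogM => //; apply: dhomogXn_var.
have nil_var a : (a < n)%N -> jac_nil m.+1 F 1 (x a.+1).
  elim: a => [|a IH] lta; apply: (@jac_nil_root _ _ _ _ _ m.+1); rewrite derF //.
    rewrite big_pred0 // subr0; apply: jac_nil_mem; last exact: jac_mem_deriv.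
    exact: dhomog_mderiv.
  apply: jac_nilD.
    by apply: jac_nil_mem; [apply: dhomog_mderiv|apply: jac_mem_deriv].
  rewrite -scaleN1r; apply/jac_nilZ/jac_nil_sum => b /eqP[ba].
  rewrite mulrA ba; apply: (nil_term 1%N); last exact: (IH (ltnW lta)).
  rewrite -mpolyC_nat mulrC mul_mpolyC; apply: dhomogZ; exact: (dhomogXn_var _ 1).
(* The derivatives yield only x_1, ..., x_n; the remaining variable comes from F itself. *)
have nil0 : jac_nil m.+1 F 1 (x 0).
  apply: (@jac_nil_root _ _ _ _ _ n).
  have -> : x 0 ^+ n = F - \sum_(a < n) x a * x a.+1 ^+ m.+1 by rewrite addrK.
  apply: jac_nilD; first by apply: jac_nil_mem => //; apply: jac_mem_self.
  rewrite -scaleN1r; apply/jac_nilZ/jac_nil_sum => a _.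
  rewrite exprS mulrA -[n]/(2 + m)%N; apply: nil_term; last exact: nil_var.
  by apply: (@dhomogM _ _ _ 1 _ 1); apply: (dhomogXn_var _ 1).
move=> i; rewrite -[i]inord_val; case: i => [[|a] lta] //=.
exact: nil_var.
Qed.

End SmoothExample.

(** In characteristic 2 the derivative of x_0 x_2 + x_1^2 in x_1 is zero, so x_1 is obtained from
    the form itself. *)
Lemma jac_nil_conic (k : fieldType) :
  exists F : {mpoly k[3]}, F \is 2.-homog /\ forall i, jac_nil 1 F 1 'X_i.
Proof.
pose x a : {mpoly k[3]} := 'X_(inord a).
pose F := x 0%N * x 2%N + x 1%N ^+ 2; exists F.
have xh a : x a \is 1.-homog by apply: (dhomogXn_var _ _ 1).
have Fn : F \is 2.-homog.
  by apply: rpredD; [apply: (dhomogM (xh _) (xh _))|apply: dhomogXn_var].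
have derF a : F^`M(inord a) = x 2%N *+ (inord 0 == inord a :> 'I_3) +
    x 0%N *+ (inord 2 == inord a :> 'I_3) + 2%:R * x 1%N *+ (inord 1 == inord a :> 'I_3).
  by rewrite /F mderivD mderivM mderiv_exp expr1 /x !mderivXU !mulr_natl !mulr_natr.
have nil2 : jac_nil 1 F 1 (x 2%N).
  rewrite (_ : x 2%N = F^`M(inord 0)).
    by apply: jac_nil_mem; [apply: dhomog_mderiv|apply: jac_mem_deriv].
  by rewrite derF !eq_inord // !mulr0n !addr0.
have nil0 : jac_nil 1 F 1 (x 0%N).
  rewrite (_ : x 0%N = F^`M(inord 2)).
    by apply: jac_nil_mem; [apply: dhomog_mderiv|apply: jac_mem_deriv].
  by rewrite derF !eq_inord // !mulr0n add0r addr0.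
have nil1 : jac_nil 1 F 1 (x 1%N).
  apply: (@jac_nil_root _ _ _ _ _ 2); have -> : 'X_(inord 1) ^+ 2 = F - x 0%N * x 2%N.
    by rewrite /F [_ * _ + _]addrC addrK.
  apply: jac_nilD; first by apply: jac_nil_mem => //; apply: jac_mem_self.
  by rewrite -scaleN1r; apply: jac_nilZ; apply: (@jac_nilM _ _ _ _ 1 1).
split=> // i; rewrite -[i]inord_val; case: i => [[|[|[|]]]] //=.
Qed.

Lemma jac_nil_example (k : fieldType) m :
  exists F : {mpoly k[m.+3]}, F \is m.+2.-homog /\ forall i, jac_nil m.+1 F 1 'X_i.
Proof.
case: m => [|m]; first exact: jac_nil_conic.
by have [n0|n0] := eqVneq (m.+3%:R : k) 0; [apply: jac_nil_chain|apply: jac_nil_fermat].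
Qed.

Section GenericSmoothness.
Variables (k : fieldType) (m : nat).
Local Notation n := m.+2.
Local Notation N := #|monoms n n|.

Lemma jac_comb_sum (I : finType) (c : I -> k) (G : I -> {mpoly k[n.+1]}) u v :
  jac_comb (\sum_i c i *: G i) u v = \sum_i c i *: jac_comb (G i) u v.
Proof.
rewrite /jac_comb mulr_sumr.
under [X in _ + X]eq_bigr do rewrite (big_morph _ (mderivD _) (mderiv0 _ _)) mulr_sumr.
rewrite exchange_big -big_split; apply: eq_bigr => i _ /=.
rewrite scalerDr -scalerAr scaler_sumr; congr (_ + _).
by apply: eq_bigr => j _; rewrite mderivZ scalerAr.
Qed.

(* If the monomials of degree D are combinations of F0 and its derivatives, the
   same combinations for F have a coefficient matrix that is linear in F and is
   the identity at F0; where it is invertible, a singular point of F would have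
   all its monomials of degree D equal to 0. *)
Theorem generic_smooth : exists2 P : {mpoly k[N]}, P != 0 &
  forall F : {mpoly k[n.+1]}, F \is n.-homog -> P.@[coefs n n F] != 0 ->
    smooth_hypersurface F.
Proof.
have [F0 [F0n nilX]] := jac_nil_example k m.
have [D [D0 memD]] := jac_mem_monomials nilX.
pose ND := #|monoms n D|.
have /fin_all_exists[u uP] (i : 'I_ND) := memD _ (mdeg_mon i).
have {uP}/fin_all_exists[v uvP] := uP.
pose T l : 'M[k]_ND := \matrix_(i, j) (jac_comb 'X_[@mon n n l] (u i) (v i))@_(mon j).
pose TF F : 'M[k]_ND := \matrix_(i, j) (jac_comb F (u i) (v i))@_(mon j).
have TE F : F \is n.-homog -> TF F = \sum_l coefs n n F l *: T l.
  move=> Fn; apply/matrixP => i j; rewrite mxE -{1}(form_of_coefs Fn) jac_comb_sum.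
  rewrite raddf_sum summxE; apply: eq_bigr => l _ /=.
  by rewrite !mxE mcoeffZ.
pose P : {mpoly k[N]} := \det (\sum_l 'X_l *: map_mx (@mpolyC N k) (T l)).
have PE F : F \is n.-homog -> P.@[coefs n n F] = \det (TF F).
  move=> /TE ->; rewrite -det_map_mx raddf_sum; congr (\det _).
  apply: eq_bigr => l _ /=; rewrite map_mxZ /= mevalXU -map_mx_comp; congr (_ *: _).
  by apply/matrixP => i j; rewrite mxE /= mevalC.
exists P.
  suff: P.@[coefs n n F0] != 0 by apply: contraNneq => ->; rewrite meval0.
  rewrite PE // (_ : TF F0 = 1%:M) ?det1 ?oner_neq0 //.
  apply/matrixP => i j.
  rewrite [LHS]mxE; have [_ <-] := uvP i; rewrite mcoeffX mxE.
  by rewrite (inj_eq (@mon_inj _ _)).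
move=> F Fn; rewrite PE // -unitfE -unitmxE => TU p [i0 pi0] Fp.
have [j|dF0] := pickP (fun j => (F^`M(j)).@[p] != 0); first by exists j.
have monp : \col_j ('X_[mon j]).@[p] = 0 :> 'cV[k]_ND.
  apply: (can_inj (mulKmx TU)); rewrite mulmx0; apply/matrixP => i j'; rewrite !mxE.
  have [[uD vD] _] := uvP i.
  have combD : jac_comb F (u i) (v i) \is D.-homog.
    apply: rpredD; first exact: uD.
    by apply: rpred_sum => j _; apply: vD; apply: dhomog_mderiv.
  transitivity (jac_comb F (u i) (v i)).@[p].
    rewrite -[in RHS](form_of_coefs combD) raddf_sum; apply: eq_bigr => j _ /=.
    by rewrite !mxE mevalZ.
  rewrite mevalD mevalM Fp mulr0 add0r raddf_sum big1 // => j _ /=.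
  by rewrite mevalM; have /negbFE/eqP -> := dF0 j; rewrite mulr0.
have degX : mdeg (U_(i0) *+ D : 'X_{1..n.+1})%MM = D by rewrite mdegMn mdeg1 mul1n.
have [l lE] := mon_index degX.
have /matrixP/(_ l ord0) := monp; rewrite !mxE lE -mpolyXn rmorphXn /= mevalXU.
by move/eqP; rewrite expf_eq0 D0 (negbTE pi0).
Qed.

End GenericSmoothness.

(** * From a polynomial condition to an open set of projective space *)

Section Homogenization.
Variables (k : closedFieldType) (N : nat).

Lemma pihomog_neq0 (P : {mpoly k[N]}) : P != 0 ->
  exists d, pihomog mdeg d P != 0.
Proof.
move=> P0.
have [/existsP[d Pd]|/existsPn P0'] :=
  boolP [exists d : 'I_(msize P), pihomog mdeg d P != 0].
  by exists d.
case/eqP: P0; rewrite (pihomog_partitionE (leqnn (msize P))) big1 // => d _.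
by apply/eqP/negbNE/P0'.
Qed.

(** The coefficients of a |-> P(a c) are the values at c of the homogeneous components of P, so one
    nonzero component replaces P up to scaling c. *)
Lemma pihomog_eval_neq0 (P : {mpoly k[N]}) d (c : 'I_N -> k) :
  (pihomog mdeg d P).@[c] != 0 -> exists2 a, a != 0 & P.@[fun i => a * c i] != 0.
Proof.
move=> Pdc; pose q := mmap polyC (fun i => 'X * (c i)%:P) P.
have qE : q = \sum_(e < maxn (msize P) d.+1) ((pihomog mdeg e P).@[c])%:P * 'X^e.
  rewrite /q [X in mmap _ _ X](pihomog_partitionE (leq_maxl (msize P) d.+1)) raddf_sum.
  apply: eq_bigr => e _ /=; rewrite (mmap_scale _ _ _ (pihomogP mdeg e P)) mulrC.
  by rewrite mmap_polyC_const.
(* The factor X makes the non-root a nonzero. *)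
have q0 : q * 'X != 0.
  rewrite mulf_neq0 ?polyX_eq0 //; apply: contraNneq Pdc => q0.
  have := congr1 (fun p : {poly k} => p`_d) q0; rewrite coef0 qE coef_sum.
  have ltd : (d < maxn (msize P) d.+1)%N by rewrite leq_maxr.
  rewrite (bigD1 (Ordinal ltd)) //= coefCM coefXn eqxx mulr1 big1 ?addr0 => [->//|e ed].
  rewrite coefCM coefXn (_ : (d == e :> nat) = false) ?mulr0 //.
  by apply: contraNF ed => /eqP de; apply/eqP/val_inj.
have /closed_nonrootP[a] := q0; rewrite /root hornerM hornerX mulf_eq0 negb_or.
move=> /andP[qa a0]; exists a => //; suff <- : q.[a] = P.@[fun i => a * c i] by [].
rewrite horner_mmap_polyC; apply: meval_eq => i.
by rewrite hornerM hornerX hornerC.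
Qed.

Lemma nonempty_open_nonvanishing (G : {mpoly k[N]}) d (i0 : 'I_N) :
  G \is d.-homog -> G != 0 ->
  nonempty_open (fun c => proj_point c /\ G.@[c] != 0).
Proof.
move=> Gd G0; split.
  exists (fun H => H = G); split=> [H ->|c]; first by exists d.
  by split=> [[cP Gc]|[cP [H -> Gc]]]; split=> //; exists G.
(* The extra variable keeps c away from the origin, also when G is constant. *)
have /mpoly_nonzero_eval[c] : G * 'X_i0 != 0.
  by rewrite mulf_neq0 // -msize_poly_eq0 msizeX.
by rewrite mevalM mevalXU mulf_eq0 negb_or => /andP[Gc ci]; exists c; split=> //; exists i0.
Qed.

End Homogenization.

Lemma smooth_scale (k : fieldType) n (F : {mpoly k[n.+1]}) a : a != 0 ->
  smooth_hypersurface (a *: F) -> smooth_hypersurface F.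
Proof.
move=> a0 aF p pP Fp; have [|j] := aF p pP; first by rewrite mevalZ Fp mulr0.
by rewrite mderivZ mevalZ mulf_eq0 negb_or => /andP[_ dF]; exists j.
Qed.

Lemma cone_syz_scale (k : fieldType) m (b : 'I_#|monoms m.+2 m.+2| -> k) a l :
  cone_syz (fun i => a * b i) l = a *: cone_syz b l.
Proof. by rewrite scaler_sumr; apply: eq_bigr => i _; rewrite scalerA. Qed.

Lemma cone_form_scale (k : fieldType) m (b : 'I_#|monoms m.+2 m.+2| -> k) a :
  cone_form (fun i => a * b i) = a *: cone_form b.
Proof. by rewrite scaler_sumr; apply: eq_bigr => i _; rewrite scalerA. Qed.

Theorem theorem1p3 (k : closedFieldType) (n : nat) (hn : (2 <= n)%N) :
  exists U : ('I_#|monoms n n| -> k) -> Prop,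
    nonempty_open U /\
    forall F : {mpoly k[n.+1]}, F \is n.-homog -> U (coefs n n F) ->
      fano_hypersurface n F /\
      exists f : n.+1.-tuple {mpoly k[2]},
        [/\ P1_morphism n f, lies_on f F
          & sheaf_iso (pullback_tangent F f)
              (split_bundle k (2%N :: nseq (n - 2) 1%N))].
Proof.
case: n hn => [|[|m]] // _.
have [P1 P1n0 P1P] := generic_form_through_rnc k m.
have [P2 P2n0 P2P] := generic_smooth k m.
have [d Gn0] : exists d, pihomog mdeg d (P1 * P2) != 0.
  by apply: pihomog_neq0; rewrite mulf_neq0.
have [i0 _] : exists i0, @mon m.+2 m.+2 i0 = (U_(ord0) *+ m.+2)%MM.
  by apply: mon_index; rewrite mdegMn mdeg1 mul1n.
exists (fun c => proj_point c /\ (pihomog mdeg d (P1 * P2)).@[c] != 0); split.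
  exact: nonempty_open_nonvanishing i0 (pihomogP _ _ _) Gn0.
move=> F Fn [[i ci] /pihomog_eval_neq0[a a0]].
rewrite mevalM mulf_eq0 negb_or => /andP[P1c P2c].
have aFn : a *: F \is m.+2.-homog by apply: dhomogZ.
have coefs_aF : coefs m.+2 m.+2 (a *: F) =1 (fun i => a * coefs m.+2 m.+2 F i).
  by move=> j; rewrite /coefs mcoeffZ.
split.
  split=> //; first by apply: contraNneq ci => ->; rewrite /coefs mcoeff0.
  apply: (smooth_scale a0); apply: P2P => //.
  by rewrite (meval_eq _ coefs_aF).
have [A [b [A_unit b_nondeg bE]]] := P1P _ P1c.
(* The generic statement applies to a F; since cone forms and their r are linear in b, dividing b by
   a gives it for F. *)
pose b' j := a^-1 * b j.
have FE : F = linear_comp A (cone_form b').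
  rewrite cone_form_scale /linear_comp comp_mpolyZ -/(linear_comp A _) -bE.
  apply: (scalerI a0); rewrite scalerA mulfV // scale1r -(form_of_coefs aFn).
  by apply: eq_bigr => j _; rewrite coefs_aF.
exists (rnc_transform A); rewrite FE; split.
- exact: rnc_transform_morphism.
- apply: rnc_transform_lies_on => //; first exact: dhomog_cone_form.
  exact: rnc_eval_cone_form.
apply: (@rnc_transform_tangent _ _ _ _ (cone_syz b')) => //.
- exact: dhomog_cone_form.
- exact: size_cone_syz.
- move=> z sz zr; apply: b_nondeg => //; apply: (@scalerI _ _ a^-1).
    by rewrite invr_eq0.
  rewrite scaler0 -[RHS]zr scaler_sumr; apply: eq_bigr => l _.
  by rewrite cone_syz_scale scalerAr.
- exact: cone_form_gradient.
Qed.
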